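(* Let $(M,E,\rho)$ be an almost co-CR quaternionic manifold and let $Z$ be the bundle of admissible linear complex structures on $E$. Let $\nabla$ be a compatible connection on $E$, and let $R$ and $T$ be the curvature form and the torsion (with respect to $\rho$) of $\nabla$, respectively. For $J\in Z$ denote $E^J=\ker(J+\mathrm{i})\subseteq E^{\mathbb{C}}$. Then the following assertions are equivalent: (i) $(E,\rho,\nabla)$ is integrable; (ii) $R\bigl(\Lambda^{2}(\rho(E^J))\bigr)(E^J)\subseteq E^J$ and $T\bigl(\Lambda^2(E^J)\bigr)\subseteq\rho(E^J)$, for any $J\in Z$.
   Context: A quaternionic vector bundle is a real vector bundle $E$ whose structural group is $\mathrm{Sp}(1)\cdot\mathrm{GL}(k,\mathbb{H})$ acting on $\mathbb{H}^k$ by $(\pm(a,A),q)\mapsto aqA^{-1}$. The morphism $\mathrm{Sp}(1)\cdot\mathrm{GL}(k,\mathbb{H})\to\mathrm{SO}(3)$, $\pm(a,A)\mapsto\pm a$, induces an oriented Riemannian vector bundle of rank three (a subbundle of $\mathrm{End}(E)$) whose sphere bundle $\pi:Z\to M$ is the bundle of admissible linear complex structures of $E$ (fibrewise, these are the left multiplications by imaginary unit quaternions). A connection on $E$ is compatible if it is compatible with the structural group of $E$; it then induces a connection on $Z$. An almost co-CR quaternionic structure on a manifold $M$ is a pair $(E,\rho)$, where $E$ is a quaternionic vector bundle over $M$ and $\rho:E\to TM$ is a surjective morphism of vector bundles whose kernel contains no nonzero subspace preserved by some admissible linear complex structure of $E$; then $(M,E,\rho)$ is an almost co-CR quaternionic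 manifold. Given a compatible connection $\nabla$ on $E$, for $J\in Z$ let $\mathcal{B}_J\subseteq T_J^{\mathbb{C}}Z$ be the horizontal lift, with respect to $\nabla$, of $\rho(\ker(J+\mathrm{i}))\subseteq T^{\mathbb{C}}_{\pi(J)}M$. Let $\mathcal{C}=(\ker \mathrm{d}\pi)^{0,1}\oplus\mathcal{B}$, a complex distribution on $Z$ with $\mathcal{C}+\overline{\mathcal{C}}=T^{\mathbb{C}}Z$. One says that $(E,\rho,\nabla)$ is integrable (equivalently, $(M,E,\rho,\nabla)$ is co-CR quaternionic) if $\mathcal{C}$ is integrable, i.e. its sections are closed under the Lie bracket. The torsion (with respect to $\rho$) of $\nabla$ is the section $T$ of $TM\otimes\Lambda^2E^*$ characterised by $T(s_1,s_2)=\rho\circ(\nabla_{\rho\circ s_1}s_2-\nabla_{\rho\circ s_2}s_1)-[\rho\circ s_1,\rho\circ s_2]$ for any local sections $s_1,s_2$ of $E$. The tensors $\rho$, $R$, $T$ are extended complex-linearly to complexifications. *)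

(* Defs.v *)
From HB Require Import structures.
From mathcomp Require Import all_boot all_order all_algebra.
From mathcomp Require Import all_classical all_reals all_analysis.
From mathcomp Require Import ring.

Set Implicit Arguments.
Unset Strict Implicit.
Unset Printing Implicit Defensive.

Import Order.TTheory GRing.Theory Num.Theory.
Import numFieldNormedType.Exports.
Local Open Scope classical_set_scope.
Local Open Scope ring_scope.

(** * Smooth maps between normed spaces *)

Fixpoint cont_diff (R : realType) (V W : normedModType R) (m : nat)
    (U : set V) (f : V -> W) : Prop :=
  match m with
  | 0 => forall x, U x -> {for x, continuous f}
  | m'.+1 => (forall x, U x -> differentiable f x) /\
             (forall v, cont_diff m' U (fun x => 'D_v f x))
  end.

Definition smooth (R : realType) (V W : normedModType R)
    (U : set V) (f : V -> W) : Prop := forall m, cont_diff m U f.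

(** The value at a point is meaningful for differentiable fields only. *)
Definition lie_bracket (R : realType) (V : normedModType R) (X Y : V -> V) :
    V -> V :=
  fun p => 'D_(X p) Y p - 'D_(Y p) X p.

Section ProductRule.
Variables (R : realType) (V W : normedModType R).

Lemma scale_is_bilinear :
  bilinear_for (GRing.Scale.Law.clone _ _ *:%R _)
               (GRing.Scale.Law.clone _ _ *:%R _) (@GRing.scale R W).
Proof. by split=> [u'|u] a x y /=; rewrite ?scalerDl ?scalerDr ?scalerA // mulrC. Qed.

HB.instance Definition _ := bilinear_isBilinear.Build R R W W _ _
  (@GRing.scale R W) scale_is_bilinear.

Lemma differentiable_scale (a : V -> R) (b : V -> W) x v :
  differentiable a x -> differentiable b x ->
  differentiable (fun z => a z *: b z) x /\
  'D_v (fun z => a z *: b z) x = 'D_v a x *: b x + a x *: 'D_v b x.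
Proof.
move=> da db.
have dp : differentiable (fun z => (a z, b z)) x by exact: differentiable_pair.
have sc : continuous (fun p : R * W => p.1 *: p.2) by exact: scale_continuous.
have ds := @differentiable_bilin _ _ _ _ (@GRing.scale R W) (a x, b x) sc.
pose g := (fun p : R * W => p.1 *: p.2).
have dg : differentiable (g \o (fun z => (a z, b z))) x by exact: differentiable_comp.
split; first exact: dg.
rewrite (deriveE _ dg) diff_comp //= diff_pair //= (@diff_bilin _ _ _ _ (@GRing.scale R W)) //=.
by rewrite addrC !deriveE.
Qed.

Lemma differentiable_sum_fam n (h : 'I_n -> V -> W) x v :
  (forall l, differentiable (h l) x) ->
  differentiable (fun z => \sum_l h l z) x /\
  'D_v (fun z => \sum_l h l z) x = \sum_l 'D_v (h l) x.
Proof.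
move=> dh.
have -> : (fun z => \sum_l h l z) = \sum_l h l.
  by apply/funext => z; rewrite fct_sumE.
split; first exact: differentiable_sum.
by rewrite derive_sum // => l; exact: diff_derivable.
Qed.


End ProductRule.

Lemma differentiable_entry (R : realType) (V : normedModType R) (k m : nat)
    (s : V -> 'M[R]_(k, m)) x v a b :
  differentiable s x ->
  differentiable (fun z => s z a b) x /\
  'D_v (fun z => s z a b) x = ('D_v s x) a b.
Proof.
move=> ds.
pose f := (fun N : 'M[R]_(k, m) => N a b).
have lf : linear f by move=> c M N; rewrite /f !mxE.
pose F : {linear _ -> _} := HB.pack f (GRing.isLinear.Build _ _ _ _ _ lf).
have cF : continuous F by exact: coord_continuous.
have dF p : differentiable F p by exact/linear_differentiable.
have dFs : differentiable (F \o s) x by exact: differentiable_comp.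
split; first exact: dFs.
rewrite [LHS](_ : _ = 'D_v (F \o s) x) // deriveE // diff_comp //.
rewrite [LHS]/(comp _ _ _) /comp.
have -> : 'd F (s x) = F :> (_ -> _) by exact: diff_lin.
by rewrite deriveE.
Qed.

Lemma derive_hom (R : realType) (V : normedModType R) (n k m : nat)
    (L : V -> 'Hom('M[R]_(k, m), 'rV[R]_n)) (s : V -> 'M[R]_(k, m)) x v :
  (forall q, differentiable (fun z => L z q) x) -> differentiable s x ->
  'D_v (fun z => L z (s z)) x =
  'D_v (fun z => L z (s x)) x + L x ('D_v s x).
Proof.
move=> dL ds.
have E z q : L z q = \sum_a \sum_b q a b *: L z (delta_mx a b).
  rewrite {1}[q]matrix_sum_delta linear_sum; apply: eq_bigr => a _.
  by rewrite linear_sum; apply: eq_bigr => b _; rewrite linearZ.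
have de a b := (differentiable_entry v a b ds).
have aux (c : 'I_k -> 'I_m -> V -> R) :
    (forall a b, differentiable (c a b) x) ->
    'D_v (fun z => \sum_a \sum_b c a b z *: L z (delta_mx a b)) x =
    \sum_a \sum_b ('D_v (c a b) x *: L x (delta_mx a b) +
                   c a b x *: 'D_v (fun z => L z (delta_mx a b)) x).
  move=> dc.
  have h1 a b := @differentiable_scale _ _ _ _ _ _ v (dc a b) (dL (delta_mx a b)).
  have h2 a := @differentiable_sum_fam _ _ _ _ _ _ v (fun b => (h1 a b).1).
  rewrite (@differentiable_sum_fam _ _ _ _ _ _ v (fun a => (h2 a).1)).2.
  apply: eq_bigr => a _; rewrite (h2 a).2; apply: eq_bigr => b _.
  by rewrite (h1 a b).2.
under [in LHS]eq_fun do rewrite E.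
under [in X in _ = X + _]eq_fun do rewrite E.
rewrite aux; last by move=> a b; exact: (de a b).1.
rewrite (aux (fun a b => cst (s x a b))); last by move=> a b; exact: differentiable_cst.
rewrite E -big_split; apply: eq_bigr => a _.
rewrite -big_split; apply: eq_bigr => b _ /=.
by rewrite (de a b).2 derive_cst scale0r add0r addrC.
Qed.

(** * Complexification: the pair [(v, w)] stands for [v + i w] *)

Definition cplx (V : Type) : Type := (V * V)%type.

Definition mul_i (V : zmodType) (z : cplx V) : cplx V := (- z.2, z.1).

Definition cadd (V : zmodType) (z w : cplx V) : cplx V :=
  (z.1 + w.1, z.2 + w.2).

Definition ext1 (V W : Type) (f : V -> W) (z : cplx V) : cplx W :=
  (f z.1, f z.2).

Definition ext2 (U V : Type) (W : zmodType) (b : U -> V -> W)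
    (z : cplx U) (w : cplx V) : cplx W :=
  (b z.1 w.1 - b z.2 w.2, b z.1 w.2 + b z.2 w.1).

(** * Quaternions, in the basis 1, i, j, k *)

Definition quat (R : realType) : Type := 'rV[R]_4.

HB.instance Definition _ (R : realType) :=
  NormedModule.copy (quat R) 'rV[R]_4.

Section QuaternionRing.
Variable R : realType.
Implicit Types a b c : quat R.

Definition mkquat (r x y z : R) : quat R := \row_(l < 4) [:: r; x; y; z]`_l.

Definition qone : quat R := mkquat 1 0 0 0.

Definition qmul a b : quat R :=
  mkquat (a 0 0 * b 0 0 - a 0 1 * b 0 1 - a 0 2 * b 0 2 - a 0 3 * b 0 3)
         (a 0 0 * b 0 1 + a 0 1 * b 0 0 + a 0 2 * b 0 3 - a 0 3 * b 0 2)
         (a 0 0 * b 0 2 - a 0 1 * b 0 3 + a 0 2 * b 0 0 + a 0 3 * b 0 1)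
         (a 0 0 * b 0 3 + a 0 1 * b 0 2 - a 0 2 * b 0 1 + a 0 3 * b 0 0).

Lemma quatP a b :
  a 0 0 = b 0 0 -> a 0 1 = b 0 1 -> a 0 2 = b 0 2 -> a 0 3 = b 0 3 -> a = b.
Proof.
move=> h0 h1 h2 h3; apply/rowP => l.
have : l \in [:: 0; 1; 2; 3 : 'I_4].
  by case: l => [[|[|[|[|l]]]] hl] //; rewrite !inE -!val_eqE.
by rewrite !inE => /or4P[] /eqP->.
Qed.

Lemma mkquat0 r x y z : mkquat r x y z 0 0 = r. Proof. by rewrite mxE. Qed.
Lemma mkquat1 r x y z : mkquat r x y z 0 1 = x. Proof. by rewrite mxE. Qed.
Lemma mkquat2 r x y z : mkquat r x y z 0 2 = y. Proof. by rewrite mxE. Qed.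
Lemma mkquat3 r x y z : mkquat r x y z 0 3 = z. Proof. by rewrite mxE. Qed.
Definition mkquatE := (mkquat0, mkquat1, mkquat2, mkquat3).

Lemma quatDE a b l : (a + b) 0 l = a 0 l + b 0 l.
Proof. exact: mxE. Qed.

Lemma qmulA : associative qmul.
Proof. by move=> a b c; apply: quatP; rewrite !mkquatE; ring. Qed.

Lemma qmul1l : left_id qone qmul.
Proof. by move=> a; apply: quatP; rewrite !mkquatE; ring. Qed.

Lemma qmul1r : right_id qone qmul.
Proof. by move=> a; apply: quatP; rewrite !mkquatE; ring. Qed.

Lemma qmulDl : left_distributive qmul +%R.
Proof. by move=> a b c; apply: quatP; rewrite !(quatDE, mkquatE); ring. Qed.

Lemma qmulDr : right_distributive qmul +%R.
Proof. by move=> a b c; apply: quatP; rewrite !(quatDE, mkquatE); ring. Qed.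

Lemma qone_neq0 : qone != 0.
Proof.
apply/eqP => /(congr1 (fun a : quat R => a 0 0)).
by rewrite mkquatE mxE; apply/eqP/oner_neq0.
Qed.

HB.instance Definition _ := GRing.Zmodule_isNzRing.Build (quat R)
  qmulA qmul1l qmul1r qmulDl qmulDr qone_neq0.

Definition qdot a b : R := \sum_(l < 4) a 0 l * b 0 l.

(** [Sp(1)] *)
Definition unit_quat a : Prop := qdot a a = 1.

Definition imaginary a : Prop := a 0 0 = 0.

(** The two-sphere parametrising the admissible complex structures. *)
Definition imag_unit a : Prop := imaginary a /\ unit_quat a.

End QuaternionRing.

(** * The model fibre [H^k]: the [i]-th row holds the [i]-th quaternion *)

Notation Hk R k := 'M[R]_(k, 4).

Section ModelFibre.
Variables (R : realType) (k : nat).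
Implicit Types (q : Hk R k) (u a : quat R).

Definition hvec q : 'rV[quat R]_k := \row_(i < k) (row i q : quat R).

Definition hmx (v : 'rV[quat R]_k) : Hk R k :=
  \matrix_(i < k, l < 4) (v 0 i : quat R) 0 l.

Definition lmulq u q : Hk R k := hmx (u *: hvec q).

(** [Sp(1).GL(k,H)] acting by [q |-> a q A^-1] (here [B = A^-1]). *)
Definition quat_group (g : Hk R k -> Hk R k) : Prop :=
  exists a (A B : 'M[quat R]_k),
    [/\ unit_quat a, A *m B = 1%:M, B *m A = 1%:M &
        forall q, g q = hmx (a *: (hvec q *m B))].

(** The Lie algebra of [quat_group]. *)
Definition quat_lie (g : Hk R k -> Hk R k) : Prop :=
  exists a (A : 'M[quat R]_k),
    imaginary a /\ forall q, g q = hmx (a *: hvec q - hvec q *m A).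

(** [E^J = ker (J + i)] for [J] the left multiplication by [u]. *)
Definition EJ u : set (cplx (Hk R k)) :=
  [set e | cadd (ext1 (lmulq u) e) (mul_i e) = (0, 0)].

End ModelFibre.

(** * Manifolds, bundles and connections *)

(** [param i] inverts [chart i] on [dom i]; the charts are those of an atlas
    over which the bundles considered below are trivial (every bundle admits
    such an atlas). *)
Record manifold (R : realType) (n : nat) := Manifold {
  mtop :> topologicalType;
  idx : Type;
  dom : idx -> set mtop;
  chart : idx -> mtop -> 'rV[R]_n;
  param : idx -> 'rV[R]_n -> mtop;
  manifold_hausdorff : hausdorff_space mtop;
  manifold_countable : @second_countable mtop;
  dom_open : forall i, open (dom i);
  dom_cover : forall x, exists i, dom i x;
  chart_open : forall i, open (chart i @` dom i);
  chartK : forall i x, dom i x -> param i (chart i x) = x;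
  chart_cont : forall i x, dom i x -> {for x, continuous (chart i)};
  param_cont : forall i y, (chart i @` dom i) y -> {for y, continuous (param i)};
  trans_smooth : forall i j,
    smooth (chart j @` (dom i `&` dom j)) (chart i \o param j) }.

Definition coords (R : realType) (n : nat) (M : manifold R n) (i : idx M) :
  set 'rV[R]_n := chart i @` dom i.

(** A quaternionic vector bundle, given by its cocycle: the local components
    of a section [s] satisfy [s_i = trans i j s_j]. *)
Record quat_bundle (R : realType) (n : nat) (M : manifold R n) (k : nat) :=
  QuatBundle {
  trans : idx M -> idx M -> M -> Hk R k -> Hk R k;
  trans_group : forall i j x, dom i x -> dom j x -> quat_group (trans i j x);
  trans_cocycle : forall i j l x q, dom i x -> dom j x -> dom l x ->
    trans i j x (trans j l x q) = trans i l x q;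
  trans_bundle_smooth : forall i j q,
    smooth (chart j @` (dom i `&` dom j))
           (fun y => trans i j (param j y) q) }.

(** A morphism of vector bundles [E -> TM]: [rho i y] is its expression in the
    [i]-th chart and trivialisation, at the point with coordinates [y]. *)
Record anchor (R : realType) (n k : nat) (M : manifold R n)
    (E : quat_bundle M k) := Anchor {
  rho : idx M -> 'rV[R]_n -> 'Hom(Hk R k, 'rV[R]_n);
  rho_smooth : forall i q, smooth (coords i) (fun y => rho i y q);
  rho_glue : forall i j x q, dom i x -> dom j x ->
    rho i (chart i x) (trans E i j x q) =
    'D_(rho j (chart j x) q) (chart i \o param j) (chart j x) }.

Definition almost_coCR (R : realType) (n k : nat) (M : manifold R n)
    (E : quat_bundle M k) (r : anchor E) : Prop :=
  forall (i : idx M) (y : 'rV[R]_n), coords i y ->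
    limg (rho r i y) = fullv /\
    forall (u : quat R) (V : {vspace Hk R k}), imag_unit u ->
      (V <= lker (rho r i y))%VS ->
      (forall q, q \in V -> lmulq u q \in V) -> V = 0%VS.

(** A compatible connection, by its local connection forms: the covariant
    derivative of [s] along [v] is [D_v s + conn i y v s], see [cov] below. *)
Record connection (R : realType) (n k : nat) (M : manifold R n)
    (E : quat_bundle M k) := Connection {
  conn : idx M -> 'rV[R]_n -> 'Hom('rV[R]_n, 'End(Hk R k));
  conn_smooth : forall i v q, smooth (coords i) (fun y => conn i y v q);
  conn_compatible : forall i y v, coords i y -> quat_lie (conn i y v);
  conn_glue : forall i j x v q, dom i x -> dom j x ->
    'D_v (fun y => trans E i j (param j y) q) (chart j x)
      + conn i (chart i x) ('D_v (chart i \o param j) (chart j x))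
          (trans E i j x q)
    = trans E i j x (conn j (chart j x) v q) }.

Section Twistor.
Variables (R : realType) (n k : nat) (M : manifold R n) (E : quat_bundle M k).
Variables (r : anchor E) (nabla : connection E) (i : idx M).
Implicit Types (y v w : 'rV[R]_n) (q : Hk R k) (u : quat R).
Implicit Types (s : 'rV[R]_n -> Hk R k) (X : 'rV[R]_n -> 'rV[R]_n).

Definition cov X s : 'rV[R]_n -> Hk R k :=
  fun y => 'D_(X y) s y + conn nabla i y (X y) (s y).

(** On constant fields, whose bracket is 0, and constant sections; this is
    [D_v Gamma_w - D_w Gamma_v + [Gamma_v, Gamma_w]] with [Gamma] the local
    connection form. *)
Definition curvature y v w q : Hk R k :=
  cov (cst v) (cov (cst w) (cst q)) y - cov (cst w) (cov (cst v) (cst q)) y.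

Definition torsion_sections s1 s2 : 'rV[R]_n -> 'rV[R]_n :=
  let X1 := fun z => rho r i z (s1 z) in
  let X2 := fun z => rho r i z (s2 z) in
  fun y => rho r i y (cov X1 s2 y - cov X2 s1 y) - lie_bracket X1 X2 y.

(** The value on sections depends only on their values at the point, see
    [torsion_sectionsE]. *)
Definition torsion y q1 q2 : 'rV[R]_n := torsion_sections (cst q1) (cst q2) y.

Lemma torsion_sectionsE s1 s2 y : coords i y ->
  differentiable s1 y -> differentiable s2 y ->
  torsion_sections s1 s2 y = torsion y (s1 y) (s2 y).
Proof.
move=> Uy d1 d2.
have dr q : differentiable (fun z => rho r i z q) y.
  by have [h _] := @rho_smooth _ _ _ _ _ r i q 1%N; exact: h.
have E1 s v : differentiable s y -> 'D_v (fun z => rho r i z (s z)) y =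
    'D_v (fun z => rho r i z (s y)) y + rho r i y ('D_v s y).
  by move=> ds; exact: derive_hom.
rewrite /torsion /torsion_sections /cov /lie_bracket.
have alg (a b c d e f : 'rV[R]_n) :
    a + b - (c + d) - ((e + a) - (f + c)) = b - d - (e - f).
  by apply/rowP => l; rewrite !mxE; ring.
rewrite (E1 s2 _ d2) (E1 s1 _ d1) !derive_cst !add0r.
rewrite linearB /= 2!(linearD (rho r i y)) alg.
by rewrite (linearB (rho r i y)).
Qed.

(** [rho (E^J)] *)
Definition rhoEJ y u : set (cplx 'rV[R]_n) := ext1 (rho r i y) @` EJ u.

(** Over the [i]-th chart, [Z] is the submanifold of [coords i * quat] formed
    of the points [(y, u)] with [u] an imaginary unit; [(y, u)] stands for the
    complex structure [lmulq u] of the fibre at [y]. *)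
Definition twistor : set ('rV[R]_n * quat R) :=
  [set p | coords i p.1 /\ imag_unit p.2].

(** [w] is tangent at [u] to the sphere of imaginary units. *)
Definition sphere_tangent u (w : quat R) : Prop :=
  imaginary w /\ qdot u w = 0.

(** [(ker d pi)^{0,1}] at [(y, u)]; the complex structure of the fibre is
    [w |-> u w], that is [A |-> J A] on endomorphisms. *)
Definition vert01 (p : 'rV[R]_n * quat R) : set (cplx ('rV[R]_n * quat R)) :=
  [set X | [/\ ext1 fst X = (0, 0),
               sphere_tangent p.2 X.1.2, sphere_tangent p.2 X.2.2 &
               cadd (ext1 ( *%R p.2) (ext1 snd X))
                    (mul_i (ext1 snd X)) = (0, 0)]].

(** [X] is horizontal at [(y, u)] for the connection induced on [Z]: the
    derivative of [J] along [X] equals [- [conn X, J]]. *)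
Definition horizontal (p X : 'rV[R]_n * quat R) : Prop :=
  forall q, lmulq X.2 q + (conn nabla i p.1 X.1 (lmulq p.2 q)
                           - lmulq p.2 (conn nabla i p.1 X.1 q)) = 0.

(** The horizontal lift of [rho (ker (J + i))]. *)
Definition BJ (p : 'rV[R]_n * quat R) : set (cplx ('rV[R]_n * quat R)) :=
  [set X | [/\ horizontal p X.1, horizontal p X.2 &
               rhoEJ p.1 p.2 (ext1 fst X)]].

Definition CJ (p : 'rV[R]_n * quat R) : set (cplx ('rV[R]_n * quat R)) :=
  [set X | exists V B, [/\ vert01 p V, BJ p B & X = cadd V B]].

(** Sections of [C] over [W `&` twistor] are represented by smooth complex
    fields on the open set [W]; both fields being tangent to [Z], the values
    of their bracket on [Z] depend only on their restrictions to [Z]. *)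
Definition involutive : Prop :=
  forall (W : set ('rV[R]_n * quat R))
         (X1 X2 Y1 Y2 : 'rV[R]_n * quat R -> 'rV[R]_n * quat R),
    open W -> W `<=` [set p | coords i p.1] ->
    smooth W X1 -> smooth W X2 -> smooth W Y1 -> smooth W Y2 ->
    (forall p, W p -> twistor p -> CJ p (X1 p, X2 p)) ->
    (forall p, W p -> twistor p -> CJ p (Y1 p, Y2 p)) ->
    forall p, W p -> twistor p ->
      CJ p (ext1 (fun Z => Z p) (ext2 (@lie_bracket R _) (X1, X2) (Y1, Y2))).

End Twistor.

(** Closedness under the bracket is local, hence it is enough to consider the
    open subsets of [Z] lying over a chart. *)
Definition integrable_coCR (R : realType) (n k : nat) (M : manifold R n)
    (E : quat_bundle M k) (r : anchor E) (nabla : connection E) : Prop :=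
  forall i : idx M, involutive r nabla i.

(* Main.v *)
(** Over a chart, a point of [Z] is a pair [(y, u)] with [u] an imaginary unit
    quaternion, the horizontal lift of [v] has fibre component
    [theta v = u Gamma(v) - Gamma(v) u], and [E^J] consists of the vectors
    [q + i u q]. A section of [C] is thus [(rho e, theta (rho e) + W)] with [e] in
    [E^J] and [W = w + i u w], where [u w + w u = 0]. Differentiating these
    relations along [Z] shows that the bracket of two sections, with data [e], [W]
    and [e'], [W'], projects to [- T(e, e')] modulo [rho(E^J)], and that its
    vertical part is [[J, R(rho e, rho e')]] modulo the vectors of type (0,1). The
    first lies in [rho(E^J)] if and only if [T(e, e')] does; the second is of type
    (0,1) if and only if [R(rho e, rho e')] preserves [E^J]. Since every pair
    [e], [e'] is the value of horizontal sections of [C], both implications follow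
    from this computation. *)

From HB Require Import structures.
Require Import Defs.
From mathcomp Require Import all_boot all_order all_algebra.
From mathcomp Require Import all_classical all_reals all_analysis.
From mathcomp Require Import ring.

Set Implicit Arguments.
Unset Strict Implicit.
Unset Printing Implicit Defensive.

Import Order.TTheory GRing.Theory Num.Theory.
Import numFieldNormedType.Exports.
Local Open Scope classical_set_scope.
Local Open Scope ring_scope.

(** * Directional derivatives *)

(** The obstacle: a section of [C] is a pair of fields on an open set of the ambient space,
    constrained on [Z] alone, and neither [e] nor [W] is given as a function. Relations valid on [Z]
    may be differentiated only along directions tangent to the sphere of imaginary units, and only
    once they are written between maps differentiable in the ambient space. For [W] this is
    immediate: it is the fibre component minus [theta] of the base component. For [e] it rests on
    the co-CR condition, which makes [q |-> (rho q, rho (u q))] injective, so that [q] is recovered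
    from the base components. Elements of [E^J] and vertical vectors of type (0,1) are represented
    by their real parts, and each complex identity becomes a pair of real ones. Identities between
    quaternions are proved by letting both sides act on [H^k], because the connection form is an
    endomorphism there, of which only the commutators with left multiplications are quaternions. *)

Definition deriv_at (R : realType) (V W : normedModType R) (f : V -> W)
    (x v : V) (d : W) : Prop := differentiable f x /\ 'D_v f x = d.

Section DerivAt.
Variables (R : realType) (V W : normedModType R).
Implicit Types (f g : V -> W) (x v : V).

Lemma deriv_at_cst (a : W) x v : deriv_at (fun=> a) x v 0.
Proof. by split; [exact: differentiable_cst | exact: derive_cst]. Qed.

Lemma deriv_atD f g x v df dg : deriv_at f x v df -> deriv_at g x v dg ->
  deriv_at (fun z => f z + g z) x v (df + dg).
Proof.
move=> [hf <-] [hg <-]; split; first exact: differentiableD.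
by rewrite -deriveD //; exact: diff_derivable.
Qed.

Lemma deriv_atN f x v df : deriv_at f x v df ->
  deriv_at (fun z => - f z) x v (- df).
Proof.
move=> [hf <-]; split; first exact: differentiableN.
by rewrite -deriveN //; exact: diff_derivable.
Qed.

Lemma deriv_atB f g x v df dg : deriv_at f x v df -> deriv_at g x v dg ->
  deriv_at (fun z => f z - g z) x v (df - dg).
Proof. by move=> hf hg; apply: deriv_atD hf (deriv_atN hg). Qed.

Lemma deriv_at_eq f x v d d' : deriv_at f x v d -> d = d' ->
  deriv_at f x v d'.
Proof. by move=> h <-. Qed.

Lemma deriv_at_unique f x v d d' : deriv_at f x v d -> deriv_at f x v d' ->
  d = d'.
Proof. by move=> [_ <-] [_ <-]. Qed.

Lemma deriv_at_derive f x v : differentiable f x -> deriv_at f x v ('D_v f x).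
Proof. by []. Qed.

Lemma deriv_at_scale (a : V -> R) f x v da df :
  deriv_at a x v da -> deriv_at f x v df ->
  deriv_at (fun z => a z *: f z) x v (da *: f x + a x *: df).
Proof. by move=> [ha <-] [hf <-]; exact: differentiable_scale. Qed.

Lemma deriv_at_sum m (f : 'I_m -> V -> W) x v df :
  (forall l, deriv_at (f l) x v (df l)) ->
  deriv_at (fun z => \sum_l f l z) x v (\sum_l df l).
Proof.
move=> h; have [d e] := @differentiable_sum_fam _ _ _ _ f x v (fun l => (h l).1).
by split=> //; rewrite e; apply: eq_bigr => l _; exact: (h l).2.
Qed.

(** The first order expansion of [f] at [x] is also one of [g], since the two agree on a
    neighbourhood; uniqueness of the differential turns it into differentiability of [g]. *)
Lemma near_eq_differentiable f g x :
  (\forall z \near x, f z = g z) -> differentiable f x -> differentiable g x.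
Proof.
move=> fg df.
have gE : g \o shift x = cst (g x) + 'd f x +o_ 0 id.
  apply/eqaddoP => _/posnumP[e].
  have /eqaddoP/(_ e%:num [gt0 of e%:num]) := diff_locally df.
  have fg0 : \forall z \near 0, f (z + x) = g (z + x).
    move: fg; rewrite (near_shift 0 x) /= => fg1; apply: filterS fg1 => z.
    by rewrite /= subr0.
  rewrite -(nbhs_singleton fg) /=; apply: filterS2 fg0 => z.
  by rewrite /cst /= !fctE => ->.
have dg : 'd g x = 'd f x :> (V -> W).
  apply: diff_unique => //.
  by case/diff_locallyP: df.
by apply/diff_locallyP; rewrite dg; split=> //; case/diff_locallyP: df.
Qed.

Lemma deriv_at_near f g x v d :
  (\forall z \near x, f z = g z) -> deriv_at f x v d -> deriv_at g x v d.
Proof.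
move=> fg [df <-]; split; first exact: near_eq_differentiable df.
by apply: near_eq_derive; apply: filterS fg => z ->.
Qed.

End DerivAt.

Section Composition.
Variables (R : realType) (U V W : normedModType R).

Lemma deriv_at_comp (f : U -> V) (g : V -> W) x v df :
  deriv_at f x v df -> differentiable g (f x) ->
  deriv_at (fun z => g (f z)) x v ('D_df g (f x)).
Proof.
move=> [hf <-] hg; have h : differentiable (g \o f) x by exact: differentiable_comp.
by split=> //; rewrite (deriveE _ h) diff_comp //= !deriveE.
Qed.

End Composition.

Section Products.
Variables (R : realType) (U V W : normedModType R).

Lemma deriv_at_pair (f : U -> V) (g : U -> W) x v df dg :
  deriv_at f x v df -> deriv_at g x v dg ->
  deriv_at (fun z => (f z, g z)) x v (df, dg).
Proof.
move=> [hf <-] [hg <-]; have h := differentiable_pair hf hg.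
by split=> //; rewrite (deriveE _ h) diff_pair //= !deriveE.
Qed.

Lemma deriv_at_fst (f : U -> V * W) x v df :
  deriv_at f x v df -> deriv_at (fun z => (f z).1) x v df.1.
Proof.
have d1 z : differentiable (fst : V * W -> V) z.
  apply: linear_differentiable => p; exact: cvg_fst.
move=> hf; have h := deriv_at_comp hf (d1 _).
apply: (deriv_at_eq h).
rewrite deriveE // diff_lin // => p; exact: cvg_fst.
Qed.

Lemma deriv_at_snd (f : U -> V * W) x v df :
  deriv_at f x v df -> deriv_at (fun z => (f z).2) x v df.2.
Proof.
have d1 z : differentiable (snd : V * W -> W) z.
  apply: linear_differentiable => p; exact: cvg_snd.
move=> hf; have h := deriv_at_comp hf (d1 _).
apply: (deriv_at_eq h).
rewrite deriveE // diff_lin // => p; exact: cvg_snd.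
Qed.

End Products.

Lemma deriv_at_id (R : realType) (V : normedModType R) (x v : V) :
  deriv_at (fun z : V => z) x v v.
Proof.
split; last exact: derive_id.
by apply: (@linear_differentiable _ _ _ idfun) => z; exact: cvg_id.
Qed.


(** * Product rules for families of linear maps *)

Section LinearFamily.
Variables (R : realType) (V W : normedModType R) (k m : nat).

(** Expansion in the matrix units reduces the rule to scalars times vectors, so that derivatives of
    [B] at fixed matrices suffice. It serves for [rho], the connection form, quaternion products and
    [theta]. *)
Lemma deriv_at_family (B : V -> 'M[R]_(k, m) -> W) (s : V -> 'M[R]_(k, m))
    x v dB ds :
  (forall z, linear (B z)) -> (forall q, deriv_at (B^~ q) x v (dB q)) ->
  deriv_at s x v ds ->
  deriv_at (fun z => B z (s z)) x v (dB (s x) + B x ds).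
Proof.
move=> lB hB hs.
have BE z q : B z q = \sum_a \sum_b q a b *: B z (delta_mx a b).
  pose F : {linear 'M[R]_(k, m) -> W} :=
    HB.pack (B z) (GRing.isLinear.Build _ _ _ _ _ (lB z)).
  rewrite {1}[q]matrix_sum_delta -[B z]/(F : _ -> _) linear_sum; apply: eq_bigr => a _.
  by rewrite linear_sum; apply: eq_bigr => b _; rewrite linearZ.
have main (t : V -> 'M[R]_(k, m)) dt : deriv_at t x v dt ->
    deriv_at (fun z => B z (t z)) x v
      (\sum_a \sum_b (dt a b *: B x (delta_mx a b) +
                       t x a b *: dB (delta_mx a b))).
  move=> [ht <-]; under eq_fun do rewrite BE.
  apply: deriv_at_sum => a; apply: deriv_at_sum => b.
  by apply: deriv_at_scale (hB _); apply: differentiable_entry.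
apply: deriv_at_eq (main _ _ hs) _.
(* The same computation for the constant map [s x] expresses [dB (s x)] through the matrix units. *)
rewrite (deriv_at_unique (hB (s x)) (main _ _ (deriv_at_cst (s x) x v))).
rewrite BE -big_split; apply: eq_bigr => a _.
rewrite -big_split; apply: eq_bigr => b _ /=.
by rewrite mxE scale0r add0r addrC.
Qed.

Lemma deriv_at_linear (L : 'M[R]_(k, m) -> W) (s : V -> 'M[R]_(k, m)) x v ds :
  linear L -> deriv_at s x v ds -> deriv_at (fun z => L (s z)) x v (L ds).
Proof.
move=> lL hs.
apply: deriv_at_eq (deriv_at_family (B := fun=> L) (dB := fun=> 0) _ _ hs) _ => //.
  by move=> q; exact: deriv_at_cst.
by rewrite add0r.
Qed.

End LinearFamily.

Section Matrices.
Variables (R : realType) (V : normedModType R).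

Lemma deriv_at_entry k m (s : V -> 'M[R]_(k, m)) x v ds i j :
  deriv_at s x v ds -> deriv_at (fun z => s z i j) x v (ds i j).
Proof. by move=> [hs <-]; exact: differentiable_entry. Qed.

Lemma differentiable_matrix k m (s : V -> 'M[R]_(k, m)) x :
  (forall i j, differentiable (fun z => s z i j) x) -> differentiable s x.
Proof.
move=> h; have -> : s = fun z => \sum_i \sum_j s z i j *: delta_mx i j.
  by apply/funext => z; exact: matrix_sum_delta.
(* Only differentiability is kept, so any direction serves and [0] is a default. *)
have h2 i j := @deriv_at_scale _ _ _ _ _ x 0 _ _
    (deriv_at_derive 0 (h i j)) (deriv_at_cst (delta_mx i j : 'M[R]_(k, m)) x 0).
exact: (deriv_at_sum (fun i => deriv_at_sum (h2 i))).1.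
Qed.

Lemma differentiable_row_mx m1 m2 (s : V -> 'rV[R]_m1) (t : V -> 'rV[R]_m2) x :
  differentiable s x -> differentiable t x ->
  differentiable (fun z => row_mx (s z) (t z)) x.
Proof.
move=> hs ht; apply: differentiable_matrix => a b; rewrite -(splitK b).
case: (fintype.split b) => c /=.
  under eq_fun do rewrite row_mxEl.
  exact: (deriv_at_entry a c (deriv_at_derive 0 hs)).1.
under eq_fun do rewrite row_mxEr.
exact: (deriv_at_entry a c (deriv_at_derive 0 ht)).1.
Qed.

Lemma differentiable_prod (I : Type) (r : seq I) (f : I -> V -> R) x :
  (forall i, differentiable (f i) x) ->
  differentiable (fun z => \prod_(i <- r) f i z) x.
Proof.
move=> h; elim: r => [|i r IH].
  by under eq_fun do rewrite big_nil; exact: differentiable_cst.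
by under eq_fun do rewrite big_cons; exact: differentiableM.
Qed.

Lemma differentiable_bigsum (I : Type) (r : seq I) (f : I -> V -> R) x :
  (forall i, differentiable (f i) x) ->
  differentiable (fun z => \sum_(i <- r) f i z) x.
Proof.
move=> h; elim: r => [|i r IH].
  by under eq_fun do rewrite big_nil; exact: differentiable_cst.
by under eq_fun do rewrite big_cons; exact: differentiableD.
Qed.

Lemma differentiable_det m (s : V -> 'M[R]_m) x :
  (forall i j, differentiable (fun z => s z i j) x) ->
  differentiable (fun z => \det (s z)) x.
Proof.
move=> h; apply: differentiable_bigsum => p.
apply: differentiableM; first exact: differentiable_cst.
exact: differentiable_prod.
Qed.

Lemma differentiable_adj m (s : V -> 'M[R]_m) x :
  (forall i j, differentiable (fun z => s z i j) x) ->
  differentiable (fun z => \adj (s z)) x.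
Proof.
move=> h; apply: differentiable_matrix => i j.
under eq_fun do rewrite mxE.
apply: differentiableM; first exact: differentiable_cst.
apply: differentiable_det => a b.
by under eq_fun do rewrite !mxE; exact: h.
Qed.

Lemma differentiable_mulmx m1 m2 m3 (s : V -> 'M[R]_(m1, m2))
    (t : V -> 'M[R]_(m2, m3)) x :
  differentiable s x -> differentiable t x ->
  differentiable (fun z => s z *m t z) x.
Proof.
move=> hs ht; apply: differentiable_matrix => i j.
under eq_fun do rewrite mxE.
apply: differentiable_bigsum => l; apply: differentiableM.
  exact: (deriv_at_entry i l (deriv_at_derive 0 hs)).1.
exact: (deriv_at_entry l j (deriv_at_derive 0 ht)).1.
Qed.

End Matrices.

(** * Quaternions acting on the model fibre *)

Section Quaternions.
Variable R : realType.
Implicit Types a b u w : quat R.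

Lemma qmulE a b : a * b = qmul a b. Proof. by []. Qed.

Lemma quatNE a l : (- a) 0 l = - a 0 l. Proof. exact: mxE. Qed.

Lemma quatZE (c : R) a l : (c *: a) 0 l = c * a 0 l. Proof. exact: mxE. Qed.

Lemma quat0E l : (0 : quat R) 0 l = 0. Proof. exact: mxE. Qed.

Lemma quat1E : (1 : quat R) = mkquat 1 0 0 0. Proof. by []. Qed.

Definition quatE := (qmulE, quat1E, mkquatE, quatDE, quatNE, quatZE, quat0E).

Lemma qscale_mull (c : R) a b : (c *: a) * b = c *: (a * b).
Proof. by apply: quatP; rewrite !quatE; ring. Qed.

Lemma qscale_mulr (c : R) a b : a * (c *: b) = c *: (a * b).
Proof. by apply: quatP; rewrite !quatE; ring. Qed.

Lemma qdotE a b :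
  qdot a b = a 0 0 * b 0 0 + a 0 1 * b 0 1 + a 0 2 * b 0 2 + a 0 3 * b 0 3.
Proof.
rewrite /qdot !big_ord_recr big_ord0 /= add0r.
by congr (_ * _ + _ * _ + _ * _ + _ * _); congr (fun_of_matrix _ _ _); apply: val_inj.
Qed.

Lemma imag_unit_sqr u : imag_unit u -> u * u = -1.
Proof.
case; rewrite /imaginary /unit_quat qdotE => u0 u1.
apply: quatP; rewrite !quatE.
- by rewrite -u1 u0; clear u0 u1; ring.
- by rewrite u0; clear u0 u1; ring.
- by rewrite u0; clear u0 u1; ring.
- by rewrite u0; clear u0 u1; ring.
Qed.

(** For imaginary [u] one has [u w + w u = 2 Re(w) u - 2 <u, w>]. Tangency in this form can be
    differentiated by the product rule. *)
Lemma sphere_tangentP u w : imag_unit u ->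
  sphere_tangent u w <-> u * w + w * u = 0.
Proof.
case; rewrite /sphere_tangent /imaginary /unit_quat !qdotE => u0 u1; split.
  move=> [w0]; rewrite u0 w0 => uw; apply: quatP;
    rewrite !quatE w0 u0; try by clear; ring.
  rewrite -[RHS](mulr0 (- 2)) -[in RHS]uw.
  by clear; ring.
move=> uw; have c l : (u * w + w * u) 0 l = 0 by rewrite uw quat0E.
have := c 0; have := c 1; have := c 2; have := c 3; clear c uw.
rewrite !quatE u0; rewrite u0 mul0r add0r in u1 *.
set a := u 0 1 in u1 *; set b := u 0 2 in u1 *; set d := u 0 3 in u1 *.
move: (w 0 0) (w 0 1) (w 0 2) (w 0 3) => x y z t e3 e2 e1 e0.
(* The imaginary components [e1], [e2], [e3] are [2 x] times those of [u]; pairing them with [u], of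
   norm one, isolates [2 x]. *)
have x0 : 2 * x = 0.
  have F p q r : p = 0 -> q = 0 -> r = 0 -> a * p + b * q + d * r = 0.
    by move=> -> -> ->; rewrite !mulr0 !addr0.
  by rewrite -[RHS](F _ _ _ e1 e2 e3) -[LHS]mulr1 -[X in _ * X = _]u1; clear; ring.
split; first by move/eqP: x0; rewrite mulf_eq0 pnatr_eq0 /= => /eqP.
have n2 : (- 2 : R) != 0 by rewrite oppr_eq0 pnatr_eq0.
by apply: (mulfI n2); rewrite mulr0 -[RHS]e0; clear; ring.
Qed.
End Quaternions.

Section LeftMultiplication.
Variables (R : realType) (k : nat).
Implicit Types (a b u w : quat R) (q : Hk R k).

Lemma row_hmx (v : 'rV[quat R]_k) i : row i (hmx v) = v 0 i.
Proof. by apply/rowP => l; rewrite !mxE. Qed.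

Lemma row_lmulq u q i : row i (lmulq u q) = (u : quat R) * (row i q : quat R).
Proof. by rewrite row_hmx !mxE. Qed.

Lemma lmulqDl a b q : lmulq (a + b) q = lmulq a q + lmulq b q.
Proof. by apply/row_matrixP => i; rewrite linearD /= !row_lmulq mulrDl. Qed.

Lemma lmulqZl (c : R) a q : lmulq (c *: a) q = c *: lmulq a q.
Proof. by apply/row_matrixP => i; rewrite linearZ /= !row_lmulq qscale_mull. Qed.

Lemma lmulqNl a q : lmulq (- a) q = - lmulq a q.
Proof. by apply/row_matrixP => i; rewrite linearN /= !row_lmulq mulNr. Qed.

Lemma lmulqBl a b q : lmulq (a - b) q = lmulq a q - lmulq b q.
Proof. by rewrite lmulqDl lmulqNl. Qed.

Lemma lmulqM a b q : lmulq (a * b) q = lmulq a (lmulq b q).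
Proof. by apply/row_matrixP => i; rewrite !row_lmulq mulrA. Qed.

Lemma lmulq1 q : lmulq 1 q = q.
Proof. by apply/row_matrixP => i; rewrite !row_lmulq mul1r. Qed.

Lemma lmulqDr a q q' : lmulq a (q + q') = lmulq a q + lmulq a q'.
Proof. by apply/row_matrixP => i; rewrite linearD /= !row_lmulq linearD mulrDr. Qed.

Lemma lmulqZr (c : R) a q : lmulq a (c *: q) = c *: lmulq a q.
Proof. by apply/row_matrixP => i; rewrite linearZ /= !row_lmulq linearZ qscale_mulr. Qed.

Lemma lmulqNr a q : lmulq a (- q) = - lmulq a q.
Proof. by rewrite -scaleN1r lmulqZr scaleN1r. Qed.

Lemma lmulqBr a q q' : lmulq a (q - q') = lmulq a q - lmulq a q'.
Proof. by rewrite lmulqDr lmulqNr. Qed.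

Lemma lmulq0r a : lmulq a (0 : Hk R k) = 0.
Proof. by rewrite -(scale0r (0 : Hk R k)) lmulqZr !scale0r. Qed.

Lemma lmulq0l q : lmulq 0 q = 0.
Proof. by rewrite -(scale0r (0 : quat R)) lmulqZl scale0r. Qed.

Lemma lmulq_linearr a : linear (@lmulq R k a).
Proof. by move=> c q q'; rewrite lmulqDr lmulqZr. Qed.

Lemma lmulq_linearl q : linear ((@lmulq R k)^~ q : quat R -> _).
Proof. by move=> c a b; rewrite lmulqDl lmulqZl. Qed.

Lemma imag_unit_lmulqK u q : imag_unit u -> lmulq u (lmulq u q) = - q.
Proof. by move=> /imag_unit_sqr uu; rewrite -lmulqM uu lmulqNl lmulq1. Qed.

Hypothesis k_gt0 : (0 < k)%N.

Definition unit_column : Hk R k := hmx (const_mx 1).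

Lemma row_lmulq_unit a i : row i (lmulq a unit_column) = a.
Proof. by rewrite row_lmulq row_hmx mxE mulr1. Qed.

Lemma lmulq_inj a b : (forall q, lmulq a q = lmulq b q) -> a = b.
Proof.
move=> /(_ unit_column) ab.
by rewrite -(row_lmulq_unit a (Ordinal k_gt0)) ab row_lmulq_unit.
Qed.

(** For [g] in the Lie algebra of the structural group, the commutator of [g]
    with a left multiplication is again a left multiplication; the quaternion
    is read off a vector with all entries [1]. *)
Definition commq (g : Hk R k -> Hk R k) u : quat R :=
  row (Ordinal k_gt0) (lmulq u (g unit_column) - g (lmulq u unit_column)).

Lemma commqP (g : Hk R k -> Hk R k) u q : quat_lie g ->
  lmulq (commq g u) q = lmulq u (g q) - g (lmulq u q).
Proof.
move=> [a [A [_ gE]]].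
have gi q' i : row i (g q') =
    a * (row i q' : quat R) - \sum_j (row j q' : quat R) * A j i.
  rewrite gE row_hmx mxE; congr (_ + _); first by rewrite !mxE.
  by rewrite mxE mxE; congr (- _); apply: eq_bigr => j _; rewrite mxE.
(* Right multiplication by [A] commutes with left multiplications, so only [u a - a u] survives. *)
have E q' : lmulq u (g q') - g (lmulq u q') = lmulq (u * a - a * u) q'.
  apply/row_matrixP => i; rewrite linearB /= [X in X - _ = _]row_lmulq.
  rewrite [RHS]row_lmulq !gi row_lmulq (mulrBl (row i q' : quat R)).
  have -> : \sum_j (row j (lmulq u q') : quat R) * A j i =
      u * (\sum_j (row j q' : quat R) * A j i).
    by rewrite mulr_sumr; apply: eq_bigr => j _; rewrite row_lmulq mulrA.
  by rewrite mulrBr !mulrA opprB addrA subrK.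
by rewrite /commq E row_lmulq_unit.
Qed.

End LeftMultiplication.

(** * Differentiation along the sphere of imaginary units *)

Section SphereDirections.
Variables (R : realType) (V W : normedModType R).

(** The rational curve [(1 + s)^-1 ((1 - s) u + t w)], with [s = t^2 |w|^2 / 4],
    runs on the sphere of imaginary units with velocity [w] at [t = 0]. *)
Lemma derive_on_sphere (g : V * quat R -> W) (D : set (V * quat R)) p v :
  open D -> D p -> imag_unit p.2 -> sphere_tangent p.2 v.2 ->
  (forall z, D z -> imag_unit z.2 -> g z = 0) ->
  differentiable g p -> 'D_v g p = 0.
Proof.
move=> oD Dp [iu uu] [iw uw] g0 dg.
pose m := qdot v.2 v.2 / 4.
pose s (t : R) := t * t * m.
pose c (t : R) : quat R := (1 + s t)^-1 *: ((1 - s t) *: p.2 + t *: v.2).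
have m0 : 0 <= m.
  rewrite divr_ge0 // qdotE.
  by rewrite -!expr2 !addr_ge0 // sqr_ge0.
have s0 t : 0 <= s t by rewrite mulr_ge0 // -expr2 sqr_ge0.
have s1 t : 1 + s t != 0 by rewrite gt_eqF // ltr_pwDl.
have cS t : imag_unit (c t).
  split.
    by rewrite /imaginary /c !quatE iu iw !mulr0 addr0 mulr0.
  have n4 : (4 : R) != 0 by rewrite pnatr_eq0.
  have vv : qdot v.2 v.2 = 4 * m by rewrite /m mulrCA divff ?mulr1.
  rewrite /unit_quat.
  have -> : qdot (c t) (c t) = (1 + s t)^-1 ^+ 2 *
    ((1 - s t) ^+ 2 * qdot p.2 p.2 + 2 * (1 - s t) * t * qdot p.2 v.2
       + t ^+ 2 * qdot v.2 v.2).
    by rewrite !qdotE /c !quatE; move: (1 + s t)^-1 (s t); clear; move=> *; ring.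
  rewrite uu uw vv.
  (* The choice of [m] gives [t^2 |v.2|^2 = 4 s]; tangency kills the cross term, and
     [(1 - s)^2 + 4 s = (1 + s)^2]. *)
  have -> : (1 - s t) ^+ 2 * 1 + 2 * (1 - s t) * t * 0 + t ^+ 2 * (4 * m)
     = (1 + s t) ^+ 2 by rewrite /s; clear; ring.
  by rewrite -exprMn mulVf ?expr1n.
have did : deriv_at (fun t : R => t) 0 1 1.
  by split; [exact/derivable1_diffP/derivable_id | exact: derive_id].
have dcst (a : R) : deriv_at (fun t : R => a) 0 1 0 by exact: deriv_at_cst.
have dmul (f h : R -> R) df dh : deriv_at f 0 1 df -> deriv_at h 0 1 dh ->
    deriv_at (fun t => f t * h t) 0 1 (df * h 0 + f 0 * dh).
  by move=> hf hh; exact: deriv_at_scale hf hh.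
have ds : deriv_at s 0 1 0.
  apply: deriv_at_eq (dmul _ _ _ _ (dmul _ _ _ _ did did) (dcst m)) _.
  by rewrite !mulr0 !mul0r !addr0 mul0r.
have s00 : s 0 = 0 by rewrite /s !mul0r.
have dinv : deriv_at (fun t => (1 + s t)^-1) 0 1 0.
  have d1 := deriv_atD (dcst 1) ds.
  have i1 : is_derive (0 : R) (1 : R) (fun t => 1 + s t) 0.
    split; first exact/diff_derivable/d1.1.
    by rewrite d1.2 addr0.
  have [e1 e2] := @is_deriveV R (fun t => 1 + s t) 0 0 1 (s1 0) i1.
  split; first exact/derivable1_diffP.
  by rewrite e2 scaler0.
have dc : deriv_at c 0 1 v.2.
  have h1 := deriv_at_scale (deriv_atB (dcst 1) ds) (deriv_at_cst p.2 (0 : R) (1 : R)).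
  have h2 := deriv_at_scale did (deriv_at_cst v.2 (0 : R) (1 : R)).
  apply: deriv_at_eq (deriv_at_scale dinv (deriv_atD h1 h2)) _.
  by rewrite s00 !(subr0, addr0, add0r, scale0r, scaler0, invr1, scale1r).
have dl : deriv_at (fun t : R => p.1 + t *: v.1) 0 1 v.1.
  apply: deriv_at_eq (deriv_atD (deriv_at_cst p.1 (0 : R) (1 : R))
    (deriv_at_scale did (deriv_at_cst v.1 (0 : R) (1 : R)))) _.
  by rewrite scale1r scaler0 addr0 add0r.
pose gam (t : R) : V * quat R := (p.1 + t *: v.1, c t).
have dgam : deriv_at gam 0 1 v.
  apply: deriv_at_eq (deriv_at_pair dl dc) _.
  by rewrite -surjective_pairing.
have gam0 : gam 0 = p.
  rewrite /gam /c s00 !(subr0, addr0, scale0r, invr1, scale1r).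
  by rewrite -surjective_pairing.
have dcomp : deriv_at (fun t => g (gam t)) 0 1 ('D_v g p).
  have dg0 : differentiable g (gam 0) by rewrite gam0.
  by have := deriv_at_comp dgam dg0; rewrite gam0.
(* [g] vanishes along the curve while it stays in [D], so the derivative ['D_v g p] given by the
   chain rule is that of a map that is zero near [0]. *)
have near0 : \forall t \near (0 : R), 0 = g (gam t).
  have nD : nbhs (gam 0) D by rewrite gam0; exact: open_nbhs_nbhs.
  have nD0 : \forall t \near (0 : R), D (gam t).
    exact: (differentiable_continuous dgam.1 nD).
  near=> t; rewrite g0 //; last exact: cS.
  by near: t; exact: nD0.
exact: deriv_at_unique dcomp (deriv_at_near near0 (deriv_at_cst _ _ _)).
Unshelve. all: by end_near. Qed.

End SphereDirections.

(** * Horizontal lifts to the twistor space *)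

Section ProductRules.
Variables (R : realType) (V : normedModType R) (k : nat).

Lemma deriv_at_lmulq (a : V -> quat R) (s : V -> Hk R k) x v da ds :
  deriv_at a x v da -> deriv_at s x v ds ->
  deriv_at (fun z => lmulq (a z) (s z)) x v (lmulq da (s x) + lmulq (a x) ds).
Proof.
move=> ha hs.
apply: (deriv_at_family (B := fun z => lmulq (a z)) (dB := lmulq da)) hs.
  by move=> z; exact: lmulq_linearr.
by move=> q; exact: deriv_at_linear (@lmulq_linearl R k q) ha.
Qed.

Lemma deriv_at_qmul (a b : V -> quat R) x v da db :
  deriv_at a x v da -> deriv_at b x v db ->
  deriv_at (fun z => a z * b z : quat R) x v (da * b x + a x * db).
Proof.
move=> ha hb.
apply: (deriv_at_family (B := fun z (q : quat R) => a z * q : quat R)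
   (dB := fun q : quat R => da * q : quat R)) hb.
  by move=> z c p q; rewrite mulrDr qscale_mulr.
move=> q; apply: (deriv_at_linear (L := fun p : quat R => p * q : quat R)) ha.
by move=> c p p'; rewrite mulrDl qscale_mull.
Qed.

End ProductRules.

(** * Horizontal lifts, torsion and curvature in a chart *)

Section Chart.
Variables (R : realType) (n k : nat) (k_gt0 : (0 < k)%N) (M : manifold R n).
Variables (E : quat_bundle M k) (r : anchor E) (nabla : connection E).
Variable i : idx M.
Local Notation P := ('rV[R]_n * quat R)%type.
Implicit Types (p : P) (y v w : 'rV[R]_n) (q : Hk R k) (u : quat R).

(** [(v, theta p v)] is the horizontal lift of [v] to the twistor space at
    [p]. *)
Definition theta p v : quat R := commq k_gt0 (conn nabla i p.1 v) p.2.

Lemma thetaP p v q : coords i p.1 ->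
  lmulq (theta p v) q =
  lmulq p.2 (conn nabla i p.1 v q) - conn nabla i p.1 v (lmulq p.2 q).
Proof. by move=> Uy; apply: commqP; exact: conn_compatible. Qed.

Lemma theta_linear p : linear (theta p).
Proof.
move=> c v w; rewrite /theta /commq !linearP /= !add_lfunE !scale_lfunE.
rewrite lmulqDr lmulqZr -linearP; congr (row _ _).
by rewrite scalerBr addrACA opprD.
Qed.

Definition drho y v q : 'rV[R]_n := 'D_v (fun z => rho r i z q) y.

Definition dconn y v w q : Hk R k := 'D_v (fun z => conn nabla i z w q) y.

Definition dtheta p (x : P) v : quat R := 'D_x (fun z => theta z v) p.

Lemma deriv_at_rho y q v : coords i y ->
  deriv_at (fun z => rho r i z q) y v (drho y v q).
Proof.
move=> Uy; split=> //.
by have [h _] := @rho_smooth _ _ _ _ _ r i q 1%N; exact: h.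
Qed.

Lemma deriv_at_conn y w q v : coords i y ->
  deriv_at (fun z => conn nabla i z w q) y v (dconn y v w q).
Proof.
move=> Uy; split=> //.
by have [h _] := @conn_smooth _ _ _ _ _ nabla i w q 1%N; exact: h.
Qed.

Lemma deriv_at_id1 p x : deriv_at (fun z : P => z.1) p x x.1.
Proof. exact: deriv_at_fst (deriv_at_id p x). Qed.

Lemma deriv_at_id2 p x : deriv_at (fun z : P => z.2) p x x.2.
Proof. exact: deriv_at_snd (deriv_at_id p x). Qed.

Lemma deriv_at_base (W : normedModType R) (f : 'rV[R]_n -> W) p x df :
  deriv_at f p.1 x.1 df -> deriv_at (fun z : P => f z.1) p x df.
Proof. by move=> [hf <-]; exact: deriv_at_comp (deriv_at_id1 p x) hf. Qed.

Lemma deriv_at_rhoq p x (s : P -> Hk R k) ds : coords i p.1 ->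
  deriv_at s p x ds ->
  deriv_at (fun z : P => rho r i z.1 (s z)) p x
    (drho p.1 x.1 (s p) + rho r i p.1 ds).
Proof.
move=> Uy; apply: (deriv_at_family (B := fun z : P => rho r i z.1)
  (dB := drho p.1 x.1)) => [z|q]; first exact: linearP.
exact: deriv_at_base (deriv_at_rho q _ Uy).
Qed.

Lemma deriv_at_connq p x w (s : P -> Hk R k) ds : coords i p.1 ->
  deriv_at s p x ds ->
  deriv_at (fun z : P => conn nabla i z.1 w (s z)) p x
    (dconn p.1 x.1 w (s p) + conn nabla i p.1 w ds).
Proof.
move=> Uy; apply: (deriv_at_family (B := fun z : P => conn nabla i z.1 w)
  (dB := dconn p.1 x.1 w)) => [z|q]; first exact: linearP.
exact: deriv_at_base (deriv_at_conn w q _ Uy).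
Qed.

Lemma deriv_at_commutator p x w q : coords i p.1 ->
  deriv_at (fun z : P => lmulq z.2 (conn nabla i z.1 w q) -
                         conn nabla i z.1 w (lmulq z.2 q)) p x
    (lmulq x.2 (conn nabla i p.1 w q) + lmulq p.2 (dconn p.1 x.1 w q)
     - (dconn p.1 x.1 w (lmulq p.2 q) + conn nabla i p.1 w (lmulq x.2 q))).
Proof.
move=> Uy; apply: deriv_atB.
  apply: deriv_at_lmulq (deriv_at_id2 p x) _.
  exact: deriv_at_base (deriv_at_conn w q _ Uy).
apply: deriv_at_connq => //.
apply: deriv_at_eq (deriv_at_lmulq (deriv_at_id2 p x) (deriv_at_cst q p x)) _.
by rewrite lmulq0r addr0.
Qed.

Lemma deriv_at_theta p x w : coords i p.1 ->
  deriv_at (fun z => theta z w) p x (dtheta p x w).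
Proof.
move=> Uy; split=> //; apply: (deriv_at_linear (v := 0) _ _).1.
  by move=> c v v'; rewrite linearP.
exact: deriv_at_commutator.
Qed.

Lemma coords_nbhs p : coords i p.1 -> \forall z \near p, coords i z.1.
Proof.
move=> Uy; have nU : nbhs p.1 (coords i).
  by apply: open_nbhs_nbhs; split=> //; exact: chart_open.
exact: (@cvg_fst _ _ (nbhs p.1) (nbhs p.2) _ _ nU).
Qed.

(** This is the derivative of [thetaP], an identity that holds over the open set of chart
    coordinates, hence near [p]. *)
Lemma dthetaP p x w q : coords i p.1 ->
  lmulq (dtheta p x w) q =
  lmulq x.2 (conn nabla i p.1 w q) + lmulq p.2 (dconn p.1 x.1 w q)
  - (dconn p.1 x.1 w (lmulq p.2 q) + conn nabla i p.1 w (lmulq x.2 q)).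
Proof.
move=> Uy; apply: deriv_at_unique (deriv_at_commutator x w q Uy).
apply: deriv_at_near (deriv_at_linear (@lmulq_linearl R k q) (deriv_at_theta x w Uy)).
by apply: filterS (coords_nbhs Uy) => z Uz; rewrite thetaP.
Qed.

Lemma deriv_at_thetaq p x (s : P -> 'rV[R]_n) ds : coords i p.1 ->
  deriv_at s p x ds ->
  deriv_at (fun z => theta z (s z)) p x (dtheta p x (s p) + theta p ds).
Proof.
move=> Uy; apply: (deriv_at_family (B := theta) (dB := dtheta p x)) => [z|w].
  exact: theta_linear.
exact: deriv_at_theta.
Qed.

Lemma torsionE y q1 q2 : torsion r nabla i y q1 q2 =
  rho r i y (conn nabla i y (rho r i y q1) q2 - conn nabla i y (rho r i y q2) q1)
  - (drho y (rho r i y q1) q2 - drho y (rho r i y q2) q1).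
Proof. by rewrite /torsion /torsion_sections /cov /lie_bracket !derive_cst !add0r. Qed.

Lemma curvatureE y v w q : coords i y -> curvature nabla i y v w q =
  dconn y v w q + conn nabla i y v (conn nabla i y w q)
  - (dconn y w v q + conn nabla i y w (conn nabla i y v q)).
Proof.
move=> Uy; rewrite /curvature /cov /=.
have e a : (fun z => 'D_a (cst q) z + conn nabla i z a q) =
    (fun z => conn nabla i z a q).
  by apply/funext => z; rewrite derive_cst add0r.
by rewrite !e !derive_cst !add0r.
Qed.

Lemma horizontalP p x : coords i p.1 ->
  horizontal nabla i p x <-> x.2 = theta p x.1.
Proof.
move=> Uy; split=> [h|h q].
  apply: (lmulq_inj k_gt0) => q; rewrite thetaP //; apply/eqP.
  by rewrite -subr_eq0 opprB; apply/eqP; exact: h.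
by rewrite h thetaP // addrA subrK subrr.
Qed.

End Chart.

(** * Sections of [C] *)

Lemma pair_addE (U V : zmodType) (a c : U) (b d : V) :
  (a, b) + (c, d) = (a + c, b + d).
Proof. by []. Qed.

Section ComplexDistribution.
Variables (R : realType) (n k : nat) (k_gt0 : (0 < k)%N) (M : manifold R n).
Variables (E : quat_bundle M k) (r : anchor E) (nabla : connection E).
Variable i : idx M.
Local Notation P := ('rV[R]_n * quat R)%type.
Local Notation theta := (theta k_gt0 nabla i).
Local Notation dtheta := (dtheta k_gt0 nabla i).
Local Notation drho := (drho r i).
Implicit Types (p x : P) (y v : 'rV[R]_n) (q : Hk R k) (u w : quat R).

Lemma EJP u (e : cplx (Hk R k)) : imag_unit u ->
  EJ u e <-> e.2 = lmulq u e.1.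
Proof.
move=> hu; rewrite /EJ /Defs.cadd /ext1 /mul_i /=; split.
  by move=> [/eqP + _]; rewrite subr_eq0 => /eqP.
by move=> ->; rewrite imag_unit_lmulqK // subrr addNr.
Qed.

Lemma rhoEJP y u (e : cplx 'rV[R]_n) : imag_unit u ->
  rhoEJ r i y u e <->
  exists q, e = (rho r i y q, rho r i y (lmulq u q)).
Proof.
move=> hu; split=> [[[q1 q2]]|[q ->]].
  by move=> /(EJP _ hu) /= -> <-; exists q1.
by exists (q, lmulq u q) => //; apply/EJP.
Qed.

Lemma CJP p (X : cplx P) : twistor i p -> CJ r nabla i p X <->
  exists q w, [/\ p.2 * w + w * p.2 = 0,
    X.1 = (rho r i p.1 q, theta p (rho r i p.1 q) + w) &
    X.2 = (rho r i p.1 (lmulq p.2 q),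
           theta p (rho r i p.1 (lmulq p.2 q)) + p.2 * w)].
Proof.
move=> [Uy hu]; have uu := imag_unit_sqr hu; split.
  move=> [[[V1 V1'] [V2 V2']] [[[B1 B1'] [B2 B2']] []]].
  move=> [/= V0 /(sphere_tangentP _ hu) tV1 _ [/eqP eV _]].
  move=> [/= /(horizontalP k_gt0 nabla _ Uy) /= -> /(horizontalP k_gt0 nabla _ Uy) /= ->].
  move=> /(rhoEJP _ _ hu) [q [-> ->]] ->.
  exists q, V1'; split=> //; rewrite /Defs.cadd /=.
    by case: V0 => -> _; congr (_, _); rewrite ?add0r // addrC.
  rewrite subr_eq0 in eV; rewrite (eqP eV).
  by case: V0 => _ ->; congr (_, _); rewrite ?add0r // addrC.
case: X => X1 X2 [q [w [tw /= -> ->]]].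
exists ((0, w), (0, p.2 * w)).
exists ((rho r i p.1 q, theta p (rho r i p.1 q)),
  (rho r i p.1 (lmulq p.2 q), theta p (rho r i p.1 (lmulq p.2 q)))).
split.
- split=> //=.
  + exact/sphere_tangentP.
  + apply/sphere_tangentP => //=.
    by rewrite -mulrA -mulrDr tw mulr0.
  + by rewrite /Defs.cadd /ext1 /mul_i /= subrr mulrA uu mulN1r addNr.
- split=> /=; [exact/(horizontalP k_gt0)|exact/(horizontalP k_gt0)|].
  by apply/rhoEJP => //; exists q.
- by rewrite /Defs.cadd /= !pair_addE !add0r (addrC w) (addrC (p.2 * w)).
Qed.

(** The span of [q] and [u q] is stable under [u] and lies in the kernel of [rho], hence is zero by
    the co-CR condition. *)
Lemma coCR_injective y u q : almost_coCR r -> coords i y -> imag_unit u ->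
  rho r i y q = 0 -> rho r i y (lmulq u q) = 0 -> q = 0.
Proof.
move=> /(_ i y) /[swap] Uy /(_ Uy) [_ h] hu q0 uq0.
have V0 : (<[q]> + <[lmulq u q]>)%VS = 0%VS :> {vspace Hk R k}.
  apply: (h u) => //.
    by rewrite subv_add -!memvE !memv_ker q0 uq0 eqxx.
  move=> _ /memv_addP[_ /vlineP[a ->] [_ /vlineP[b ->] ->]].
  rewrite lmulqDr !lmulqZr imag_unit_lmulqK // addrC.
  by apply: memv_add; rewrite rpredZ // ?rpredN memv_line.
have : q \in (<[q]> + <[lmulq u q]>)%VS.
  by apply: (subvP (addvSl _ _)); exact: memv_line.
by rewrite V0 memv0 => /eqP.
Qed.

Section Derivatives.
Hypothesis coCR : almost_coCR r.
Variables (D : set P) (X1 X2 : P -> P) (p : P) (q : Hk R k) (w : quat R).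
Hypotheses (oD : open D) (Dp : D p) (tp : twistor i p).
Hypotheses (dX1 : differentiable X1 p) (dX2 : differentiable X2 p).
Hypothesis DU : D `<=` [set z | coords i z.1].
Hypothesis hC : forall z, D z -> twistor i z -> CJ r nabla i z (X1 z, X2 z).
Hypothesis X1p : X1 p = (rho r i p.1 q, theta p (rho r i p.1 q) + w).
Hypothesis X2p : X2 p = (rho r i p.1 (lmulq p.2 q),
                         theta p (rho r i p.1 (lmulq p.2 q)) + p.2 * w).

Let vert (X : P -> P) z : quat R := (X z).2 - theta z (X z).1.

Let deriv_at_vert X x : differentiable X p ->
  deriv_at (vert X) p x
    (('D_x X p).2 - (dtheta p x (X p).1 + theta p ('D_x X p).1)).
Proof.
move=> dX; have h := deriv_at_derive x dX.
apply: deriv_atB (deriv_at_snd h) _.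
apply: deriv_at_thetaq (deriv_at_fst h).
exact: tp.1.
Qed.

(** On [Z] the vertical part [vert X1] anticommutes with [u], and [vert X2 = u (vert X1)]. Both
    relations are differentiated along [x]; [d x] is the derivative of [vert X1], and [x.2] is that
    of the coordinate [u]. *)
Lemma CJ_deriv_vertical : exists d : P -> quat R,
  forall x, sphere_tangent p.2 x.2 ->
  [/\ ('D_x X1 p).2 =
        dtheta p x (rho r i p.1 q) + theta p ('D_x X1 p).1 + d x,
      ('D_x X2 p).2 =
        dtheta p x (rho r i p.1 (lmulq p.2 q)) + theta p ('D_x X2 p).1
        + (x.2 * w + p.2 * d x) &
      x.2 * w + p.2 * d x + (d x * p.2 + w * x.2) = 0].
Proof.
have [Uy hu] := tp.
exists (fun x => 'D_x (vert X1) p) => x tx.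
have h1 := deriv_at_vert x dX1; have h2 := deriv_at_vert x dX2.
have vp : vert X1 p = w by rewrite /vert X1p /= addrC addKr.
have vE z : D z -> imag_unit z.2 ->
    z.2 * vert X1 z + vert X1 z * z.2 = 0 /\ vert X2 z - z.2 * vert X1 z = 0.
  move=> Dz uz; have tz : twistor i z by split=> //; exact: DU.
  have [q' [w' [tw' /= e1 e2]]] := (CJP _ tz).1 (hC Dz tz).
  have -> : vert X1 z = w' by rewrite /vert e1 /= addrC addKr.
  by rewrite tw' /vert e2 /= [_ + z.2 * w']addrC addrK subrr.
have i2 := deriv_at_id2 p x.
have h1' : deriv_at (vert X1) p x ('D_x (vert X1) p) by split; first exact: h1.1.
have e1 := deriv_at_unique h1' h1.
split.
- by rewrite e1 X1p /= addrC subrK.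
- have h := deriv_atB h2 (deriv_at_qmul i2 h1').
  have := derive_on_sphere oD Dp hu tx (fun z Dz uz => (vE z Dz uz).2) h.1.
  rewrite h.2 vp X2p /= => /eqP; rewrite subr_eq0 => /eqP <-.
  by rewrite addrC subrK.
- have h := deriv_atD (deriv_at_qmul i2 h1') (deriv_at_qmul h1' i2).
  have := derive_on_sphere oD Dp hu tx (fun z Dz uz => (vE z Dz uz).1) h.1.
  by rewrite h.2 vp.
Qed.

(** Matrix of [q |-> (rho q, rho (u q))], injective at points of [Z] by the co-CR condition. *)
Let frame (z : P) : 'M[R]_(k * 4, n + n) :=
  lin1_mx (fun a => row_mx (rho r i z.1 (vec_mx a))
                           (rho r i z.1 (lmulq z.2 (vec_mx a)))).

Let mul_frame z q' : mxvec q' *m frame z =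
  row_mx (rho r i z.1 q') (rho r i z.1 (lmulq z.2 q')).
Proof.
pose f (a : 'rV[R]_(k * 4)) := row_mx (rho r i z.1 (vec_mx a))
                           (rho r i z.1 (lmulq z.2 (vec_mx a))).
have lf : linear f.
  move=> c a b; rewrite /f !linearP lmulqDr lmulqZr linearP.
  by rewrite scale_row_mx add_row_mx.
pose F : {linear _ -> _} := HB.pack f (GRing.isLinear.Build _ _ _ _ _ lf).
by rewrite [LHS](mul_rV_lin1 F) /= /f mxvecK.
Qed.

Let differentiable_frame : differentiable frame p.
Proof.
have Uy := tp.1; apply: differentiable_matrix => a b.
pose q' : Hk R k := vec_mx (delta_mx 0 a).
have h1 := deriv_at_rhoq r Uy (deriv_at_cst q' p 0).
have h2 := deriv_at_rhoq r Uy
  (deriv_at_lmulq (deriv_at_id2 p 0) (deriv_at_cst q' p 0)).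
have h := differentiable_row_mx h1.1 h2.1.
under eq_fun do rewrite mxE.
exact: (deriv_at_entry 0 b (deriv_at_derive 0 h)).1.
Qed.

(** A left inverse at the single point [p] is enough: the square matrix [frame z *m L] is the
    identity at [p], and its adjugate exists for every [z]. *)
Let frame_left_inverse : exists L, frame p *m L = 1%:M.
Proof.
have [Uy hu] := tp; apply/row_freeP/inj_row_free => a a0.
rewrite -[a]vec_mxK mul_frame in a0.
rewrite -[a]vec_mxK (_ : vec_mx a = 0) ?linear0 //.
have := congr1 lsubmx a0; have := congr1 rsubmx a0.
rewrite row_mxKl row_mxKr !linear0 => e2 e1.
exact: (coCR_injective coCR Uy hu).
Qed.

(** On [Z], [X1] and [X2] project to [rho q] and [rho (u q)] for a unique [q].
    By the adjugate formula a multiple [del *: q], with [del = 1] at [p], extends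
    differentiably off [Z], which avoids inverting matrices near [p]. *)
Lemma CJ_deriv_horizontal : exists c : P -> Hk R k,
  forall x, sphere_tangent p.2 x.2 ->
    ('D_x X1 p).1 = drho p.1 x.1 q + rho r i p.1 (c x) /\
    ('D_x X2 p).1 = drho p.1 x.1 (lmulq p.2 q)
      + rho r i p.1 (lmulq x.2 q + lmulq p.2 (c x)).
Proof.
have [Uy hu] := tp; have [L frameL] := frame_left_inverse.
pose A z := frame z *m L.
pose del z := \det (A z).
pose xi z := row_mx (X1 z).1 (X2 z).1.
pose s z : Hk R k := vec_mx (xi z *m L *m \adj (A z)).
have dA : differentiable A p.
  by apply: differentiable_mulmx; [exact: differentiable_frame|exact: differentiable_cst].
have dAe a b : differentiable (fun z => A z a b) p.
  exact: (deriv_at_entry a b (deriv_at_derive 0 dA)).1.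
have ddel : differentiable del p by exact: differentiable_det.
have hX1 x := deriv_at_fst (deriv_at_derive x dX1).
have hX2 x := deriv_at_fst (deriv_at_derive x dX2).
have ds : differentiable s p.
  apply: (deriv_at_linear (v := 0) _ (deriv_at_derive 0 _)).1.
    by move=> c a b; rewrite linearP.
  apply: differentiable_mulmx; last exact: differentiable_adj.
  apply: differentiable_mulmx; last exact: differentiable_cst.
  by apply: differentiable_row_mx; [exact: (hX1 0).1|exact: (hX2 0).1].
(* If [xi z] is the image of [q'] under the frame, then [xi L adj(A) = q' A adj(A) = det(A) q']. *)
have sE z q' : (X1 z).1 = rho r i z.1 q' ->
    (X2 z).1 = rho r i z.1 (lmulq z.2 q') -> s z = del z *: q'.
  move=> e1 e2; rewrite /s /xi e1 e2 -mul_frame -[_ *m L]mulmxA -/(A z).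
  by rewrite -mulmxA mul_mx_adj mul_mx_scalar linearZ /= mxvecK.
have delp : del p = 1 by rewrite /del /A frameL det1.
have sp : s p = q by rewrite (sE p q) ?X1p ?X2p // delp scale1r.
have zE z : D z -> imag_unit z.2 ->
   del z *: (X1 z).1 - rho r i z.1 (s z) = 0 /\
   del z *: (X2 z).1 - rho r i z.1 (lmulq z.2 (s z)) = 0.
  move=> Dz uz; have tz : twistor i z by split=> //; exact: DU.
  have [q' [w' [_ /= e1 e2]]] := (CJP _ tz).1 (hC Dz tz).
  rewrite (sE z q') ?e1 ?e2 //= lmulqZr.
  by rewrite !linearZ /= -!scalerDr !subrr !scaler0.
(* As [s = del q] on [Z] and [del p = 1], this is the derivative of the quotient [s / del] at
   [p]. *)
exists (fun x => 'D_x s p - 'D_x del p *: q) => x tx.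
have hdel := deriv_at_derive x ddel; have hs := deriv_at_derive x ds.
split.
- have h := deriv_atB (deriv_at_scale hdel (hX1 x)) (deriv_at_rhoq r Uy hs).
  have := derive_on_sphere oD Dp hu tx (fun z Dz uz => (zE z Dz uz).1) h.1.
  rewrite h.2 delp scale1r sp X1p /= => /eqP; rewrite subr_eq0 => /eqP e.
  by rewrite linearB linearZ /= addrA -e addrAC subrr add0r.
- have h := deriv_atB (deriv_at_scale hdel (hX2 x))
    (deriv_at_rhoq r Uy (deriv_at_lmulq (deriv_at_id2 p x) hs)).
  have := derive_on_sphere oD Dp hu tx (fun z Dz uz => (zE z Dz uz).2) h.1.
  rewrite h.2 delp scale1r sp X2p /= => /eqP; rewrite subr_eq0 => /eqP e.
  rewrite lmulqBr lmulqZr addrA linearB linearZ /= addrA -e.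
  by rewrite addrAC subrr add0r.
Qed.

End Derivatives.
End ComplexDistribution.

(** * Brackets of sections of [C] *)

Section BracketAlgebra.
Import VectorInternalTheory.
Variables (R : realType) (U : vectType R).

(** The linear maps below do not commute. Once they are pushed through sums, each composite applied
    to a vector is an atom, and coordinates leave an identity of real numbers. *)
Lemma v2r_entry_inj (V : vectType R) (x y : V) :
  (forall j, v2r x 0 j = v2r y 0 j) -> x = y.
Proof. by move=> e; apply: (can_inj v2rK); apply/rowP. Qed.

Lemma v2r_entryD (V : vectType R) (x y : V) j : v2r (x + y) 0 j = v2r x 0 j + v2r y 0 j.
Proof. by rewrite linearD mxE. Qed.

Lemma v2r_entryN (V : vectType R) (x : V) j : v2r (- x) 0 j = - v2r x 0 j.
Proof. by rewrite linearN mxE. Qed.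

Lemma lin_add (f : {linear U -> U}) x y : f (x + y) = f x + f y.
Proof. exact: linearD. Qed.

Lemma lin_opp (f : {linear U -> U}) x : f (- x) = - f x.
Proof. exact: linearN. Qed.

(** [u] stands for the complex structure [J]; [a1], [a2] ([b1], [b2]) for the
    connection form on the real and imaginary parts of the projection of the
    first (second) field to [M]; [w] and [u w] ([w'] and [u w']) for the vertical
    parts, [x1], [x2] ([y1], [y2]) for the components along the fibre, and [d1],
    [d2], [e1], [e2] for the derivatives of the vertical part of one field along
    the real and imaginary parts of the other. *)
Variables u w w' a1 a2 b1 b2 d1 d2 e1 e2 x1 x2 y1 y2 : {linear U -> U}.

(** Vertical components of the four real brackets, without the horizontal lift of the projection and
    the curvature. The first index refers to the first field; [s11 - s22] and [s12 + s21] are the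
    real and imaginary parts for the complex bracket. *)
Let s11 q := w (b1 q) - b1 (w q) - (w' (a1 q) - a1 (w' q)) + (d1 q - e1 q).
Let s12 q := w (b2 q) - b2 (w q) - (u (w' (a1 q)) - a1 (u (w' q)))
  + (x1 (w' q) + u (d1 q) - e2 q).
Let s21 q := u (w (b1 q)) - b1 (u (w q)) - (w' (a2 q) - a2 (w' q))
  + (d2 q - (y1 (w q) + u (e1 q))).
Let s22 q := u (w (b2 q)) - b2 (u (w q)) - (u (w' (a2 q)) - a2 (u (w' q)))
  + (x2 (w' q) + u (d2 q) - (y2 (w q) + u (e2 q))).

Hypothesis uu : forall q, u (u q) = - q.
Hypothesis x1E : forall q, x1 q = u (a1 q) - a1 (u q) + w q.
Hypothesis x2E : forall q, x2 q = u (a2 q) - a2 (u q) + u (w q).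
Hypothesis y1E : forall q, y1 q = u (b1 q) - b1 (u q) + w' q.
Hypothesis y2E : forall q, y2 q = u (b2 q) - b2 (u q) + u (w' q).

(** The remainder is always of type (0,1): after substitution of [x1], [x2], [y1], [y2] the terms
    cancel by [u^2 = -1]. *)
Lemma bracket_type01 q : s12 q + s21 q = u (s11 q - s22 q).
Proof.
rewrite /s11 /s12 /s21 /s22 !(x1E, x2E, y1E, y2E).
rewrite !(lin_add u, lin_opp u, uu).
by apply: v2r_entry_inj => j; rewrite !(v2r_entryD, v2r_entryN); ring.
Qed.

Section Torsion.
Variables (V : vectType R) (rh : {linear U -> V}) (q q' cx1 cx2 cy1 cy2 : U).
Variables r11 r12 r21 r22 t11 t12 t21 t22 : V.

(** Read off from the real part: it collects what stands under [rh] once the torsion terms are split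
    off. The imaginary part then yields [u m], so these terms form an element of [rho (E^J)]. *)
Let m := cx1 - cy1 - u cx2 + u cy2 - u (a2 q') + u (b2 q) + a1 q' - b1 q
  - u (w q') + u (w' q).

Let rhD x y : rh (x + y) = rh x + rh y. Proof. exact: linearD. Qed.

Let rhN x : rh (- x) = - rh x. Proof. exact: linearN. Qed.

Lemma bracket_horizontal_re :
  r11 + rh cx1 - (t11 + rh cy1)
    - (r22 + rh (x2 q' + u cx2) - (t22 + rh (y2 q + u cy2))) =
  rh m - (rh (a1 q' - b1 q) - (r11 - t11)
            - (rh (a2 (u q') - b2 (u q)) - (r22 - t22))).
Proof.
rewrite /m !(x2E, y2E) !(rhD, rhN).
by apply: v2r_entry_inj => j; rewrite !(v2r_entryD, v2r_entryN); ring.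
Qed.

Lemma bracket_horizontal_im :
  r12 + rh (x1 q' + u cx1) - (t21 + rh cy2)
    + (r21 + rh cx2 - (t12 + rh (y1 q + u cy1))) =
  rh (u m) - (rh (a1 (u q') - b2 q) - (r12 - t21)
              + (rh (a2 q' - b1 (u q)) - (r21 - t12))).
Proof.
rewrite /m !(x1E, y1E) !(lin_add u, lin_opp u, uu) !(rhD, rhN).
by apply: v2r_entry_inj => j; rewrite !(v2r_entryD, v2r_entryN); ring.
Qed.

End Torsion.

Hypothesis wu : forall q, w (u q) = - u (w q).
Hypothesis w'u : forall q, w' (u q) = - u (w' q).
Hypothesis d1u : forall q, d1 (u q) = - (x1 (w' q) + u (d1 q) + w' (x1 q)).
Hypothesis d2u : forall q, d2 (u q) = - (x2 (w' q) + u (d2 q) + w' (x2 q)).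
Hypothesis e1u : forall q, e1 (u q) = - (y1 (w q) + u (e1 q) + w (y1 q)).
Hypothesis e2u : forall q, e2 (u q) = - (y2 (w q) + u (e2 q) + w (y2 q)).

(** The relations [d1u], [d2u], [e1u], [e2u] are the anticommutation of [w'] and [w] with [u],
    differentiated along the other field. Together with [wu] and [w'u] they move [u] past the
    vertical parts and their derivatives, after which all terms cancel. *)
Lemma bracket_tangent q : u (s11 q - s22 q) + (s11 (u q) - s22 (u q)) = 0.
Proof.
rewrite /s11 /s22 !(d1u, d2u, e1u, e2u) !(x1E, x2E, y1E, y2E).
rewrite !(lin_add u, lin_opp u, lin_add w, lin_opp w, lin_add w', lin_opp w').
rewrite !(uu, wu, w'u, lin_opp u, lin_opp w, lin_opp w').
rewrite !(lin_opp a1, lin_opp a2, lin_opp b1, lin_opp b2).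
rewrite ?(uu, wu, w'u, lin_opp u, lin_opp w, lin_opp w', opprK).
have v0 j : v2r (0 : U) 0 j = 0 by rewrite linear0 mxE.
by apply: v2r_entry_inj => j; rewrite !(v2r_entryD, v2r_entryN, v0); ring.
Qed.

End BracketAlgebra.

Lemma entryD (R : nmodType) a b (x y : 'M[R]_(a, b)) l m :
  (x + y) l m = x l m + y l m.
Proof. exact: mxE. Qed.

Lemma entryN (R : zmodType) a b (x : 'M[R]_(a, b)) l m : (- x) l m = - x l m.
Proof. exact: mxE. Qed.

Lemma entry0 (R : nmodType) a b l m : (0 : 'M[R]_(a, b)) l m = 0.
Proof. exact: mxE. Qed.

Ltac module_ring :=
  repeat match goal with
  | |- context [lmulq ?a ?q] => generalize (lmulq a q); intro
  | |- context [fun_of_lfun ?f ?q] => generalize (fun_of_lfun f q); intro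
  | |- context [dconn ?a ?b ?c ?d ?e] => generalize (dconn a b c d e); intro
  | |- context [drho ?a ?b ?c ?d ?e] => generalize (drho a b c d e); intro
  end;
  apply/matrixP => ? ?; rewrite !(entryD, entryN) ?entry0; ring.

HB.instance Definition _ (R : realType) (k : nat) (u : quat R) :=
  GRing.isLinear.Build R (Hk R k) (Hk R k) _ (lmulq u) (@lmulq_linearr R k u).

(** * Curvature as a derivative of horizontal lifts *)

Section Bracket.
Variables (R : realType) (n k : nat) (k_gt0 : (0 < k)%N) (M : manifold R n).
Variables (E : quat_bundle M k) (r : anchor E) (nabla : connection E).
Variable i : idx M.
Local Notation P := ('rV[R]_n * quat R)%type.
Local Notation theta := (theta k_gt0 nabla i).
Local Notation dtheta := (dtheta k_gt0 nabla i).
Local Notation drho := (drho r i).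
Local Notation rh := (rho r i).
Local Notation Ga := (conn nabla i).
Implicit Types (p x : P) (y v : 'rV[R]_n) (q : Hk R k) (u w : quat R).

Lemma connB y v q q' : Ga y v (q - q') = Ga y v q - Ga y v q'.
Proof. exact: linearB. Qed.

Lemma connD y v q q' : Ga y v (q + q') = Ga y v q + Ga y v q'.
Proof. exact: linearD. Qed.

Lemma connN y v q : Ga y v (- q) = - Ga y v q.
Proof. exact: linearN. Qed.

Lemma dconnN y v v' q : coords i y ->
  dconn nabla i y v v' (- q) = - dconn nabla i y v v' q.
Proof.
move=> Uy; apply: deriv_at_unique (deriv_atN (deriv_at_conn nabla v' q v Uy)).
have -> : (fun z => - Ga z v' q) = fun z => Ga z v' (- q).
  by apply/funext => z; rewrite linearN.
exact: deriv_at_conn.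
Qed.

Lemma curvatureN y v v' q : coords i y ->
  curvature nabla i y v v' (- q) = - curvature nabla i y v v' q.
Proof.
move=> Uy; rewrite !curvatureE // !dconnN //.
rewrite (connN y v) (connN y v') (connN y v) (connN y v').
by module_ring.
Qed.

(** The quaternion by which [[J, R(v, v')]] acts, [J] being the left
    multiplication by [p.2]. *)
Definition curvq p v v' : quat R :=
  dtheta p (v, theta p v) v' - dtheta p (v', theta p v') v.

(** The fibre velocity [theta p v = [u, Gamma(v)]] produces the quadratic terms of the curvature;
    the mixed terms [Gamma(v) u Gamma(v')] and [Gamma(v') u Gamma(v)] enter symmetrically and cancel
    in the difference. *)
Lemma curvqP p v v' q : coords i p.1 ->
  lmulq (curvq p v v') q = lmulq p.2 (curvature nabla i p.1 v v' q)
                           - curvature nabla i p.1 v v' (lmulq p.2 q).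
Proof.
move=> Uy; rewrite [LHS]lmulqBl [X in X - _ = _](dthetaP _ _ _ _ _ Uy).
rewrite [X in _ - X = _](dthetaP _ _ _ _ _ Uy).
simpl fst; simpl snd.
rewrite (thetaP _ _ v _ Uy) (thetaP _ _ v' _ Uy).
rewrite (thetaP _ _ v _ Uy) (thetaP _ _ v' _ Uy).
rewrite !(curvatureE _ _ _ _ Uy) !(connB, lmulqBr, lmulqDr).
by module_ring.
Qed.

(** A commutator with [u] anticommutes with [u], because [u^2 = -1] commutes with the curvature. *)
Lemma curvq_tangent p v v' : twistor i p ->
  p.2 * curvq p v v' + curvq p v v' * p.2 = 0.
Proof.
move=> [Uy hu]; apply: (lmulq_inj k_gt0) => q.
rewrite lmulqDl !lmulqM !curvqP // lmulqBr !imag_unit_lmulqK // curvatureN //.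
by rewrite opprK addrA subrK addNr lmulq0l.
Qed.

(** [theta (y, u) v] is linear in [u], so its derivative in the fibre direction [w] is
    [theta (p.1, w) v], where [w] need not lie on the sphere. *)
Lemma dtheta_shift p v w v' : coords i p.1 ->
  dtheta p (v, theta p v + w) v' =
  dtheta p (v, theta p v) v' + theta (p.1, w) v'.
Proof.
move=> Uy; apply: (lmulq_inj k_gt0) => q.
have tE q0 : lmulq (theta (p.1, w) v') q0 =
    lmulq w (Ga p.1 v' q0) - Ga p.1 v' (lmulq w q0).
  exact: thetaP.
rewrite [LHS](dthetaP _ _ _ _ _ Uy) [RHS]lmulqDl.
rewrite [X in _ = X + _](dthetaP _ _ _ _ _ Uy) [X in _ = _ + X]tE.
simpl fst; simpl snd.
rewrite !(lmulqDl (theta p v) w) connD.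
by module_ring.
Qed.

End Bracket.

(** * The vertical remainder of the bracket as a quaternion *)

Section VerticalAlgebra.
Variables (R : realType) (A : nzRingType) (U : vectType R).
Variable L : A -> {linear U -> U}.
Hypothesis LD : forall v v' q, L (v + v') q = L v q + L v' q.
Hypothesis LN : forall v q, L (- v) q = - L v q.
Hypothesis LM : forall v v' q, L (v * v') q = L v (L v' q).
Hypothesis L1 : forall q, L 1 q = q.
Hypothesis L_inj : forall v v', (forall q, L v q = L v' q) -> v = v'.

Variables u w w' x1 x2 y1 y2 d1 d2 e1 e2 : A.
Variables ca1 ca2 cb1 cb2 : A -> A.
Variables a1 a2 b1 b2 : {linear U -> U}.
Hypothesis uu1 : u * u = -1.
Hypothesis ca1P : forall v q, L (ca1 v) q = L v (a1 q) - a1 (L v q).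
Hypothesis ca2P : forall v q, L (ca2 v) q = L v (a2 q) - a2 (L v q).
Hypothesis cb1P : forall v q, L (cb1 v) q = L v (b1 q) - b1 (L v q).
Hypothesis cb2P : forall v q, L (cb2 v) q = L v (b2 q) - b2 (L v q).
Hypotheses (x1E : x1 = ca1 u + w) (x2E : x2 = ca2 u + u * w).
Hypotheses (y1E : y1 = cb1 u + w') (y2E : y2 = cb2 u + u * w').
Hypotheses (tw : u * w + w * u = 0) (tw' : u * w' + w' * u = 0).
Hypothesis d1u : x1 * w' + u * d1 + (d1 * u + w' * x1) = 0.
Hypothesis d2u : x2 * w' + u * d2 + (d2 * u + w' * x2) = 0.
Hypothesis e1u : y1 * w + u * e1 + (e1 * u + w * y1) = 0.
Hypothesis e2u : y2 * w + u * e2 + (e2 * u + w * y2) = 0.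

(** The combination [s11 - s22] (and [s12 + s21] for [vert_im]), written in a ring acting faithfully
    on [U]; [ca1 v] is the commutator [[v, a1]], an element of [A] although [a1] is only an
    endomorphism of [U]. *)
Definition vert_re : A :=
  cb1 w - ca1 w' + (d1 - e1)
  - (cb2 (u * w) - ca2 (u * w') + (x2 * w' + u * d2 - (y2 * w + u * e2))).

Definition vert_im : A :=
  cb2 w - ca1 (u * w') + (x1 * w' + u * d1 - e2)
  + (cb1 (u * w) - ca2 w' + (d2 - (y1 * w + u * e1))).

Let L0 q : L 0 q = 0.
Proof. by apply: (addrI (L 0 q)); rewrite -LD !addr0. Qed.

Let uu q : L u (L u q) = - q.
Proof. by rewrite -LM uu1 LN L1. Qed.

Let x1L q : L x1 q = L u (a1 q) - a1 (L u q) + L w q.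
Proof. by rewrite x1E LD ca1P. Qed.

Let x2L q : L x2 q = L u (a2 q) - a2 (L u q) + L u (L w q).
Proof. by rewrite x2E LD ca2P LM. Qed.

Let y1L q : L y1 q = L u (b1 q) - b1 (L u q) + L w' q.
Proof. by rewrite y1E LD cb1P. Qed.

Let y2L q : L y2 q = L u (b2 q) - b2 (L u q) + L u (L w' q).
Proof. by rewrite y2E LD cb2P LM. Qed.

Let anti v q : u * v + v * u = 0 -> L v (L u q) = - L u (L v q).
Proof. by move=> h; apply/eqP; rewrite -addr_eq0 addrC -!LM -LD h L0. Qed.

Let anti4 v x d q : x * v + u * d + (d * u + v * x) = 0 ->
  L d (L u q) = - (L x (L v q) + L u (L d q) + L v (L x q)).
Proof.
move=> /(congr1 (fun a => L a q)); rewrite L0 !(LD, LM) => /eqP.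
by rewrite addrCA addr_eq0 => /eqP.
Qed.

Lemma vert_imE : vert_im = u * vert_re.
Proof.
apply: L_inj => q.
have := bracket_type01 (b1 := b1) (b2 := b2) (L d1) (L d2) (L e1) (L e2)
   uu x1L x2L y1L y2L q.
rewrite /vert_im /vert_re LM !(LD, LN, LM).
by rewrite !(ca1P, ca2P, cb1P, cb2P) !LM.
Qed.

Lemma vert_re_tangent : u * vert_re + vert_re * u = 0.
Proof.
apply: L_inj => q; rewrite L0.
have := bracket_tangent uu x1L x2L y1L y2L
  (fun q => anti q tw) (fun q => anti q tw')
  (fun q => anti4 q d1u) (fun q => anti4 q d2u)
  (fun q => anti4 q e1u) (fun q => anti4 q e2u) q.
rewrite /vert_re !(LD, LN, LM).
by rewrite !(ca1P, ca2P, cb1P, cb2P) !LM.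
Qed.

End VerticalAlgebra.

Section FourTerms.
Variables (R : realType) (a b : nat).
Variables z1 z2 z3 z4 t1 t2 t3 t4 s1 s2 s3 s4 f1 f2 f3 f4 e1 e2 e3 e4
  : 'M[R]_(a, b).
Hypotheses (E1 : z1 = t1 + s1 + f1 + e1) (E2 : z2 = t2 + s2 + f2 + e2).
Hypotheses (E3 : z3 = t3 + s3 + f3 + e3) (E4 : z4 = t4 + s4 + f4 + e4).

(** Each derivative in a complex bracket splits into a derivative of [theta] along a horizontal lift
    ([t]), its correction along the fibre ([s]), [theta] of the projected derivative ([f]) and a
    derivative of the vertical part ([e]); equal types are regrouped. *)
Lemma four_terms_re : z1 - z2 - (z3 - z4) =
  f1 - f2 - (f3 - f4) +
  (t1 - t2 - (t3 - t4) + (s1 - s2 + (e1 - e2) - (s3 - s4 + (e3 - e4)))).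
Proof. by rewrite E1 E2 E3 E4; module_ring. Qed.

Lemma four_terms_im : z1 - z2 + (z3 - z4) =
  f1 - f2 + (f3 - f4) +
  (t1 - t2 + (t3 - t4) + (s1 - s2 + (e1 - e2) + (s3 - s4 + (e3 - e4)))).
Proof. by rewrite E1 E2 E3 E4; module_ring. Qed.

End FourTerms.

Section Anticommutation.
Variable A : nzRingType.
Implicit Types u a b : A.

Lemma anticommD u a b : u * a + a * u = 0 -> u * b + b * u = 0 ->
  u * (a + b) + (a + b) * u = 0.
Proof. by move=> ha hb; rewrite mulrDr mulrDl addrACA ha hb addr0. Qed.

Lemma anticommB u a b : u * a + a * u = 0 -> u * b + b * u = 0 ->
  u * (a - b) + (a - b) * u = 0.
Proof. by move=> ha hb; rewrite mulrBr mulrBl addrACA ha add0r -opprD hb oppr0. Qed.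

End Anticommutation.

(** * Membership of the bracket in [C] at a point of [Z] *)

Section Integrability.
Variables (R : realType) (n k : nat) (k_gt0 : (0 < k)%N) (M : manifold R n).
Variables (E : quat_bundle M k) (r : anchor E) (nabla : connection E).
Variable i : idx M.
Hypothesis coCR : almost_coCR r.
Local Notation P := ('rV[R]_n * quat R)%type.
Local Notation theta := (theta k_gt0 nabla i).
Local Notation dtheta := (dtheta k_gt0 nabla i).
Local Notation drho := (drho r i).
Local Notation rh := (rho r i).
Local Notation Ga := (conn nabla i).
Local Notation T := (torsion r nabla i).
Local Notation curvq := (curvq k_gt0 nabla i).

(** Horizontal lifts are tangent to [Z], since [theta] is a commutator with [u]. This allows
    relations on [Z] to be differentiated along the fields themselves. *)
Lemma theta_tangent (p : P) a v : twistor i p -> p.2 * v + v * p.2 = 0 ->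
  sphere_tangent p.2 (theta p a + v).
Proof.
move=> [Uy hu] h; apply/sphere_tangentP => //.
rewrite mulrDr mulrDl addrACA h addr0.
apply: (lmulq_inj k_gt0) => x.
rewrite [LHS]lmulqDl [X in X + _ = _]lmulqM [X in _ + X = _]lmulqM.
rewrite !(thetaP _ _ a _ Uy) lmulqBr (imag_unit_lmulqK _ hu).
by rewrite (imag_unit_lmulqK x hu) connN opprK addrA subrK addNr lmulq0l.
Qed.

Lemma mulu_tangent (u v : quat R) : u * v + v * u = 0 ->
  u * (u * v) + u * v * u = 0.
Proof. by move=> h; rewrite -mulrA -mulrDr h mulr0. Qed.

Lemma thetaD p a b : theta p (a + b) = theta p a + theta p b.
Proof. by have := theta_linear k_gt0 nabla i p 1 a b; rewrite !scale1r. Qed.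

Lemma thetaN p a : theta p (- a) = - theta p a.
Proof.
have := theta_linear k_gt0 nabla i p (-1) a 0.
have -> : theta p 0 = 0 by apply: (addrI (theta p 0)); rewrite -thetaD !addr0.
by rewrite !addr0 !scaleN1r.
Qed.

Lemma thetaB p a b : theta p (a - b) = theta p a - theta p b.
Proof. by rewrite thetaD thetaN. Qed.

Lemma thetaBB p a b c d : theta p (a - b - (c - d)) =
  theta p a - theta p b - (theta p c - theta p d).
Proof. by rewrite !thetaB. Qed.

Lemma thetaBDB p a b c d : theta p (a - b + (c - d)) =
  theta p a - theta p b + (theta p c - theta p d).
Proof. by rewrite thetaD !thetaB. Qed.

Variables (D : set P) (X1 X2 Y1 Y2 : P -> P) (p : P).
Variables (q q' : Hk R k) (w w' : quat R).
Hypotheses (oD : open D) (Dp : D p) (tp : twistor i p).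
Hypothesis DU : D `<=` [set z | coords i z.1].
Hypotheses (dX1 : differentiable X1 p) (dX2 : differentiable X2 p).
Hypotheses (dY1 : differentiable Y1 p) (dY2 : differentiable Y2 p).
Hypothesis hX : forall z, D z -> twistor i z -> CJ r nabla i z (X1 z, X2 z).
Hypothesis hY : forall z, D z -> twistor i z -> CJ r nabla i z (Y1 z, Y2 z).
Hypotheses (tw : p.2 * w + w * p.2 = 0) (tw' : p.2 * w' + w' * p.2 = 0).

Local Notation u := p.2.
Local Notation a1 := (rh p.1 q).
Local Notation a2 := (rh p.1 (lmulq u q)).
Local Notation b1 := (rh p.1 q').
Local Notation b2 := (rh p.1 (lmulq u q')).

Hypothesis X1p : X1 p = (a1, theta p a1 + w).
Hypothesis X2p : X2 p = (a2, theta p a2 + u * w).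
Hypothesis Y1p : Y1 p = (b1, theta p b1 + w').
Hypothesis Y2p : Y2 p = (b2, theta p b2 + u * w').

Let Z1 := lie_bracket X1 Y1 p - lie_bracket X2 Y2 p.
Let Z2 := lie_bracket X1 Y2 p + lie_bracket X2 Y1 p.

Let tX1 : sphere_tangent u (X1 p).2.
Proof. by rewrite X1p; exact: theta_tangent. Qed.

Let tX2 : sphere_tangent u (X2 p).2.
Proof. by rewrite X2p; apply: theta_tangent => //; exact: mulu_tangent. Qed.

Let tY1 : sphere_tangent u (Y1 p).2.
Proof. by rewrite Y1p; exact: theta_tangent. Qed.

Let tY2 : sphere_tangent u (Y2 p).2.
Proof. by rewrite Y2p; apply: theta_tangent => //; exact: mulu_tangent. Qed.

Let thetaL v (z : Hk R k) :
  lmulq (theta p v) z = lmulq u (Ga p.1 v z) - Ga p.1 v (lmulq u z).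
Proof. exact: thetaP tp.1. Qed.

Let X1L (z : Hk R k) : lmulq (X1 p).2 z =
  lmulq u (Ga p.1 a1 z) - Ga p.1 a1 (lmulq u z) + lmulq w z.
Proof. by rewrite X1p [LHS]lmulqDl thetaL. Qed.

Let X2L (z : Hk R k) : lmulq (X2 p).2 z =
  lmulq u (Ga p.1 a2 z) - Ga p.1 a2 (lmulq u z) + lmulq u (lmulq w z).
Proof. by rewrite X2p [LHS]lmulqDl thetaL lmulqM. Qed.

Let Y1L (z : Hk R k) : lmulq (Y1 p).2 z =
  lmulq u (Ga p.1 b1 z) - Ga p.1 b1 (lmulq u z) + lmulq w' z.
Proof. by rewrite Y1p [LHS]lmulqDl thetaL. Qed.

Let Y2L (z : Hk R k) : lmulq (Y2 p).2 z =
  lmulq u (Ga p.1 b2 z) - Ga p.1 b2 (lmulq u z) + lmulq u (lmulq w' z).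
Proof. by rewrite Y2p [LHS]lmulqDl thetaL lmulqM. Qed.

Lemma lie_bracket_horizontal : exists m : Hk R k,
  Z1.1 = rh p.1 m - (T p.1 q q' - T p.1 (lmulq u q) (lmulq u q')) /\
  Z2.1 = rh p.1 (lmulq u m) - (T p.1 q (lmulq u q') + T p.1 (lmulq u q) q').
Proof.
have [Uy hu] := tp.
have [c hc] := CJ_deriv_horizontal coCR oD Dp tp dX1 dX2 DU hX X1p X2p.
have [c' hc'] := CJ_deriv_horizontal coCR oD Dp tp dY1 dY2 DU hY Y1p Y2p.
have [A11 A12] := hc' _ tX1; have [A21 A22] := hc' _ tX2.
have [B11 B12] := hc _ tY1; have [B21 B22] := hc _ tY2.
have eX1 : (X1 p).1 = a1 by rewrite X1p.
have eX2 : (X2 p).1 = a2 by rewrite X2p.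
have eY1 : (Y1 p).1 = b1 by rewrite Y1p.
have eY2 : (Y2 p).1 = b2 by rewrite Y2p.
rewrite eX1 in A11 A12; rewrite eX2 in A21 A22.
rewrite eY1 in B11 B12; rewrite eY2 in B21 B22.
have Z1E : Z1.1 = ('D_(X1 p) Y1 p).1 - ('D_(Y1 p) X1 p).1
   - (('D_(X2 p) Y2 p).1 - ('D_(Y2 p) X2 p).1) by [].
have Z2E : Z2.1 = ('D_(X1 p) Y2 p).1 - ('D_(Y2 p) X1 p).1
   + (('D_(X2 p) Y1 p).1 - ('D_(Y1 p) X2 p).1) by [].
rewrite [X in _ = X - _ - _]A11 [X in _ = _ - X - _]B11
  [X in _ = _ - (X - _)]A22 [X in _ = _ - (_ - X)]B22 in Z1E.
rewrite [X in _ = X - _ + _]A12 [X in _ = _ - X + _]B21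
  [X in _ = _ + (X - _)]A21 [X in _ = _ + (_ - X)]B12 in Z2E.
have h1 := @bracket_horizontal_re R _
  (lmulq u) (lmulq w) (lmulq w') (Ga p.1 a1) (Ga p.1 a2) (Ga p.1 b1) (Ga p.1 b2)
  (lmulq (X2 p).2) (lmulq (Y2 p).2) X2L Y2L _ (rh p.1) q q'
  (c' (X1 p)) (c' (X2 p)) (c (Y1 p)) (c (Y2 p)) (drho p.1 a1 q')
  (drho p.1 a2 (lmulq u q')) (drho p.1 b1 q) (drho p.1 b2 (lmulq u q)).
have h2 := @bracket_horizontal_im R _
  (lmulq u) (lmulq w) (lmulq w') (Ga p.1 a1) (Ga p.1 a2) (Ga p.1 b1) (Ga p.1 b2)
  (lmulq (X1 p).2) (lmulq (Y1 p).2) (fun z => imag_unit_lmulqK z hu)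
  X1L Y1L _ (rh p.1) q q'
  (c' (X1 p)) (c' (X2 p)) (c (Y1 p)) (c (Y2 p)) (drho p.1 a1 (lmulq u q'))
  (drho p.1 a2 q') (drho p.1 b1 (lmulq u q)) (drho p.1 b2 q).
eexists; split.
  by rewrite [LHS]Z1E [LHS]h1 !torsionE.
by rewrite [LHS]Z2E [LHS]h2 !torsionE.
Qed.

(** The derivative of [theta] along a field splits by [dtheta_shift]: the horizontal directions
    antisymmetrise to [curvq], while the fibre directions join the derivatives of the vertical parts
    in [g]. *)
Lemma lie_bracket_vertical : exists g : quat R,
  [/\ u * g + g * u = 0,
      Z1.2 = theta p Z1.1 + (curvq p a1 b1 - curvq p a2 b2 + g) &
      Z2.2 = theta p Z2.1 + (curvq p a1 b2 + curvq p a2 b1 + u * g)].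
Proof.
have [Uy hu] := tp.
have [d hd] := CJ_deriv_vertical oD Dp tp dX1 dX2 DU hX X1p X2p.
have [d' hd'] := CJ_deriv_vertical oD Dp tp dY1 dY2 DU hY Y1p Y2p.
have [A11 A12 A1] := hd' _ tX1; have [A21 A22 A2] := hd' _ tX2.
have [B11 B12 B1] := hd _ tY1; have [B21 B22 B2] := hd _ tY2.
(* The map [x |-> [x, Gamma(v)]] on all quaternions; its value at [u] is [theta p v]. *)
pose th v (x : quat R) := theta (p.1, x) v.
have thP v x (z : Hk R k) :
    lmulq (th v x) z = lmulq x (Ga p.1 v z) - Ga p.1 v (lmulq x z).
  exact: (thetaP k_gt0 nabla (p := (p.1, x))).
have thE v : theta p v = th v u by rewrite /th -surjective_pairing.
pose g := vert_re u w w' (X2 p).2 (Y2 p).2 (d' (X1 p)) (d' (X2 p))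
   (d (Y1 p)) (d (Y2 p)) (th a1) (th a2) (th b1) (th b2).
pose L (v : quat R) : {linear Hk R k -> Hk R k} := lmulq v.
have X1E : (X1 p).2 = th a1 u + w by rewrite X1p thE.
have X2E : (X2 p).2 = th a2 u + u * w by rewrite X2p thE.
have Y1E : (Y1 p).2 = th b1 u + w' by rewrite Y1p thE.
have Y2E : (Y2 p).2 = th b2 u + u * w' by rewrite Y2p thE.
have tg := @vert_re_tangent R (quat R) _ L (@lmulqDl R k) (@lmulqNl R k)
  (@lmulqM R k) (@lmulq1 R k) (lmulq_inj k_gt0) u w w' _ _ _ _ _ _ _ _
  (th a1) (th a2) (th b1) (th b2) (Ga p.1 a1) (Ga p.1 a2) (Ga p.1 b1) (Ga p.1 b2)
  (imag_unit_sqr hu) (thP a1) (thP a2) (thP b1) (thP b2) X1E X2E Y1E Y2E tw tw'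
  A1 A2 B1 B2.
have ig := @vert_imE R (quat R) _ L (@lmulqDl R k) (@lmulqNl R k)
  (@lmulqM R k) (@lmulq1 R k) (lmulq_inj k_gt0) u w w' _ _ _ _
  (d' (X1 p)) (d' (X2 p)) (d (Y1 p)) (d (Y2 p))
  (th a1) (th a2) (th b1) (th b2) (Ga p.1 a1) (Ga p.1 a2) (Ga p.1 b1) (Ga p.1 b2)
  (imag_unit_sqr hu) (thP a1) (thP a2) (thP b1) (thP b2) X1E X2E Y1E Y2E.
have dX1E v : dtheta p (X1 p) v = dtheta p (a1, theta p a1) v + th v w.
  by rewrite X1p; exact: dtheta_shift.
have dX2E v : dtheta p (X2 p) v = dtheta p (a2, theta p a2) v + th v (u * w).
  by rewrite X2p; exact: dtheta_shift.
have dY1E v : dtheta p (Y1 p) v = dtheta p (b1, theta p b1) v + th v w'.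
  by rewrite Y1p; exact: dtheta_shift.
have dY2E v : dtheta p (Y2 p) v = dtheta p (b2, theta p b2) v + th v (u * w').
  by rewrite Y2p; exact: dtheta_shift.
rewrite [X in _ = X + _ + _]dX1E in A11; rewrite [X in _ = X + _ + _]dX1E in A12.
rewrite [X in _ = X + _ + _]dX2E in A21; rewrite [X in _ = X + _ + _]dX2E in A22.
rewrite [X in _ = X + _ + _]dY1E in B11; rewrite [X in _ = X + _ + _]dY1E in B12.
rewrite [X in _ = X + _ + _]dY2E in B21; rewrite [X in _ = X + _ + _]dY2E in B22.
exists g; split; first exact: tg.
- have e : theta p Z1.1 =
      theta p ('D_(X1 p) Y1 p).1 - theta p ('D_(Y1 p) X1 p).1
      - (theta p ('D_(X2 p) Y2 p).1 - theta p ('D_(Y2 p) X2 p).1).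
    exact: thetaBB.
  rewrite [X in _ = X + _]e.
  exact: (four_terms_re A11 B11 A22 B22).
- have e : theta p Z2.1 =
      theta p ('D_(X1 p) Y2 p).1 - theta p ('D_(Y2 p) X1 p).1
      + (theta p ('D_(X2 p) Y1 p).1 - theta p ('D_(Y1 p) X2 p).1).
    exact: thetaBDB.
  rewrite [X in _ = X + _]e -[X in _ = _ + (_ + X)]ig.
  exact: (four_terms_im A12 B21 A21 B12).
Qed.

(** The contributions of [m] and [g] always belong to [C], so membership tests the torsion and the
    curvature separately. *)
Lemma CJ_bracketP :
  CJ r nabla i p (Z1, Z2) <->
  (exists e, T p.1 q q' - T p.1 (lmulq u q) (lmulq u q') = rh p.1 e /\
             T p.1 q (lmulq u q') + T p.1 (lmulq u q) q' = rh p.1 (lmulq u e)) /\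
  curvq p a1 b2 + curvq p a2 b1 = u * (curvq p a1 b1 - curvq p a2 b2).
Proof.
have [m [m1 m2]] := lie_bracket_horizontal.
have [g [tg g1 g2]] := lie_bracket_vertical.
have rhB y z z' : rh y (z - z') = rh y z - rh y z' by exact: linearB.
split.
- move=> /(CJP k_gt0 r nabla _ tp) [q0 [v0 [_ /= e1 e2]]]; split.
    (* [rh m] minus the torsion is [rh q0], so the torsion is the image of [m - q0]. *)
    exists (m - q0); split.
      by rewrite rhB -[rh p.1 q0]/((rh p.1 q0, theta p (rh p.1 q0) + v0).1) -e1 m1 subKr.
    rewrite lmulqBr rhB -[rh p.1 (lmulq u q0)]/((rh p.1 (lmulq u q0),
      theta p (rh p.1 (lmulq u q0)) + u * v0).1).
    by rewrite -e2 m2 subKr.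
  (* The real part determines [v0]; the imaginary part [u * v0] then carries the condition on the
     curvature, [u * g] cancelling. *)
  have v0E : v0 = curvq p a1 b1 - curvq p a2 b2 + g.
    by apply: (addrI (theta p Z1.1)); rewrite -[RHS]g1 e1.
  apply: (addIr (u * g)); rewrite -mulrDr -v0E.
  by apply: (addrI (theta p Z2.1)); rewrite -[LHS]g2 e2.
- move=> [[e [e1 e2]] eK]; apply/(CJP k_gt0 r nabla _ tp).
  exists (m - e), (curvq p a1 b1 - curvq p a2 b2 + g); split.
  + by apply: anticommD tg; apply: anticommB; exact: curvq_tangent.
  + rewrite rhB -e1 -m1 -g1; exact: surjective_pairing.
  + rewrite lmulqBr rhB -e2 -m2 mulrDr -eK -g2; exact: surjective_pairing.
Qed.

End Integrability.

Lemma addrACA_sub (V : zmodType) (a b c d : V) :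
  a - b - (c - d) = a - c - (b - d).
Proof. by rewrite !opprB addrACA [RHS]addrACA [- c - b]addrC. Qed.

Lemma addrACA_add (V : zmodType) (a b c d : V) :
  a - b + (c - d) = a + c - (b + d).
Proof. by rewrite addrACA opprD. Qed.

(** * Curvature and the stability of [E^J] *)

Section CurvatureOfType20.
Variables (R : realType) (n k : nat) (k_gt0 : (0 < k)%N) (M : manifold R n).
Variables (E : quat_bundle M k) (nabla : connection E) (i : idx M).
Local Notation Rm := (curvature nabla i).
Local Notation curvq := (curvq k_gt0 nabla i).

(** Multiplication by [u]. With [a = Q1 (u x)], [b = Q2 x], [c = Q1 x], [d = Q2 (u x)], the left
    relation says that [Q1 + i Q2] maps [x + i u x] into [E^J], the right one that [[u, Q2] x = u
    [u, Q1] x]. *)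
Lemma imag_unit_transpose (u : quat R) (a b c d : Hk R k) : imag_unit u ->
  a + b = lmulq u (c - d) <-> lmulq u b - d = lmulq u (lmulq u c - a).
Proof.
move=> hu.
have e1 : lmulq u b - d - lmulq u (lmulq u c - a) = lmulq u (a + b) + (c - d).
  by rewrite lmulqBr lmulqDr (imag_unit_lmulqK _ hu); module_ring.
have e2 : lmulq u (lmulq u (a + b) + (c - d)) = - (a + b - lmulq u (c - d)).
  by rewrite lmulqDr (imag_unit_lmulqK _ hu); module_ring.
split=> [e|/eqP].
  by apply/eqP; rewrite -subr_eq0 e1 e (imag_unit_lmulqK _ hu) addNr.
rewrite -subr_eq0 e1 => /eqP e; apply/eqP.
by rewrite -subr_eq0 -oppr_eq0 -e2 e lmulq0r eqxx.
Qed.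

Lemma curvature_EJP (p : 'rV[R]_n * quat R) a1 a2 b1 b2 : twistor i p ->
  (forall e, EJ p.2 e ->
     EJ p.2 (ext2 (fun (g : Hk R k -> Hk R k) q => g q)
                  (ext2 (Rm p.1) (a1, a2) (b1, b2)) e)) <->
  curvq p a1 b2 + curvq p a2 b1 = p.2 * (curvq p a1 b1 - curvq p a2 b2).
Proof.
move=> [Uy hu].
pose Q1 x := Rm p.1 a1 b1 x - Rm p.1 a2 b2 x.
pose Q2 x := Rm p.1 a1 b2 x + Rm p.1 a2 b1 x.
have K1 x : lmulq (p.2 * (curvq p a1 b1 - curvq p a2 b2)) x =
    lmulq p.2 (lmulq p.2 (Q1 x) - Q1 (lmulq p.2 x)).
  rewrite [LHS]lmulqM; congr (lmulq _ _).
  rewrite [LHS]lmulqBl [X in X - _ = _](curvqP _ _ _ _ _ Uy).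
  rewrite [X in _ - X = _](curvqP _ _ _ _ _ Uy).
  by rewrite [X in _ = X - _]lmulqBr /Q1; exact: addrACA_sub.
have K2 x : lmulq (curvq p a1 b2 + curvq p a2 b1) x =
    lmulq p.2 (Q2 x) - Q2 (lmulq p.2 x).
  rewrite [LHS]lmulqDl [X in X + _ = _](curvqP _ _ _ _ _ Uy).
  rewrite [X in _ + X = _](curvqP _ _ _ _ _ Uy).
  by rewrite [X in _ = X - _]lmulqDr /Q2; exact: addrACA_add.
split=> [h|h [e1 e2]].
- apply: (lmulq_inj k_gt0) => x; rewrite K1 K2.
  have ex : EJ p.2 (x, lmulq p.2 x) by apply/(EJP _ hu).
  have /(EJP _ hu) /= hx := h _ ex.
  apply: (imag_unit_transpose (Q1 (lmulq p.2 x)) (Q2 x) (Q1 x)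
    (Q2 (lmulq p.2 x)) hu).1.
  exact: hx.
- move=> /(EJP _ hu) /= ->; apply/(EJP _ hu) => /=.
  apply: (imag_unit_transpose (Q1 (lmulq p.2 e1)) (Q2 e1) (Q1 e1)
    (Q2 (lmulq p.2 e1)) hu).2.
  exact: etrans (esym (K2 e1)) (etrans (congr1 (fun v => lmulq v e1) h) (K1 e1)).
Qed.

End CurvatureOfType20.

(** * Smoothness of horizontal sections *)

Section Smoothness.
Variables (R : realType) (V W : normedModType R).
Implicit Types (U : set V) (f g : V -> W).

Lemma open_near U x : open U -> U x -> \forall z \near x, U z.
Proof. by move=> oU Ux; apply: open_nbhs_nbhs; split. Qed.

Lemma cont_diffW m U f : cont_diff m.+1 U f -> cont_diff m U f.
Proof.
elim: m f => [|m IH] f [df hf].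
  by move=> x Ux; apply: differentiable_continuous; exact: df.
by split=> // v; apply: IH; exact: hf.
Qed.

Lemma cont_diff_ext m U f g : open U -> (forall x, U x -> f x = g x) ->
  cont_diff m U f -> cont_diff m U g.
Proof.
move=> oU; elim: m f g => [|m IH] f g fg.
  move=> hf x Ux.
  have fgx : \forall z \near x, f z = g z.
    by apply: filterS (open_near oU Ux) => z /fg.
  rewrite /prop_for /continuous_at -(fg x Ux).
  by apply: cvg_trans (hf x Ux); apply: near_eq_cvg; apply: filterS fgx.
move=> [df hf]; split.
  move=> x Ux; apply: near_eq_differentiable (df x Ux).
  by apply: filterS (open_near oU Ux) => z /fg.
move=> v; apply: IH (hf v) => x Ux; apply: near_eq_derive.
by apply: filterS (open_near oU Ux) => z /fg.
Qed.

Lemma cont_diff_cst m U (a : W) : cont_diff m U (fun=> a).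
Proof.
elim: m a => [|m IH] a; first by move=> x _; exact: cvg_cst.
split=> [x _|v]; first exact: differentiable_cst.
by under eq_fun do rewrite derive_cst; exact: IH.
Qed.

Lemma cont_diffD m U f g : open U -> cont_diff m U f -> cont_diff m U g ->
  cont_diff m U (fun z => f z + g z).
Proof.
move=> oU; elim: m f g => [|m IH] f g.
  by move=> hf hg x Ux; apply: cvgD; [exact: hf|exact: hg].
move=> [df hf] [dg hg].
have h x v (Ux : U x) := deriv_atD (deriv_at_derive v (df x Ux))
                                   (deriv_at_derive v (dg x Ux)).
split=> [x Ux|v]; first exact: (h x 0 Ux).1.
by apply: cont_diff_ext oU _ (IH _ _ (hf v) (hg v)) => x Ux; rewrite (h x v Ux).2.
Qed.

End Smoothness.

Section SmoothScaling.
Variables (R : realType) (V W : normedModType R).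
Implicit Types (U : set V) (f g : V -> W).

Lemma cont_diff_scale m U (a : V -> R) f : open U ->
  cont_diff m U a -> cont_diff m U f -> cont_diff m U (fun z => a z *: f z).
Proof.
move=> oU; elim: m a f => [|m IH] a f.
  by move=> ha hf x Ux; apply: cvgZ; [exact: ha|exact: hf].
move=> ha hf; have [da ha'] := ha; have [df hf'] := hf.
have h x v (Ux : U x) := deriv_at_scale (deriv_at_derive v (da x Ux))
                                   (deriv_at_derive v (df x Ux)).
split=> [x Ux|v]; first exact: (h x 0 Ux).1.
have h1 := IH _ _ (ha' v) (cont_diffW hf).
have h2 := IH _ _ (cont_diffW ha) (hf' v).
by apply: cont_diff_ext oU _ (cont_diffD oU h1 h2) => x Ux; rewrite (h x v Ux).2.
Qed.

Lemma cont_diff_sum m l U (f : 'I_l -> V -> W) : open U ->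
  (forall j, cont_diff m U (f j)) -> cont_diff m U (fun z => \sum_j f j z).
Proof.
move=> oU; elim: l f => [|l IH] f hf.
  by under eq_fun do rewrite big_ord0; exact: cont_diff_cst.
under eq_fun do rewrite big_ord_recr.
by apply: cont_diffD => //; apply: IH.
Qed.

End SmoothScaling.

Section SmoothProducts.
Variables (R : realType) (V : normedModType R).

Lemma cont_diff_pair (W1 W2 : normedModType R) m (U : set V)
    (f : V -> W1) (g : V -> W2) :
  open U -> cont_diff m U f -> cont_diff m U g ->
  cont_diff m U (fun z => (f z, g z)).
Proof.
move=> oU; elim: m f g => [|m IH] f g.
  by move=> hf hg x Ux; apply: cvg_pair; [exact: hf|exact: hg].
move=> [df hf] [dg hg].
have h x v (Ux : U x) := deriv_at_pair (deriv_at_derive v (df x Ux))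
                                   (deriv_at_derive v (dg x Ux)).
split=> [x Ux|v]; first exact: (h x 0 Ux).1.
by apply: cont_diff_ext oU _ (IH _ _ (hf v) (hg v)) => x Ux; rewrite (h x v Ux).2.
Qed.

Lemma cont_diff_entry m k l (U : set V) (s : V -> 'M[R]_(k, l)) i j :
  open U -> cont_diff m U s -> cont_diff m U (fun z => s z i j).
Proof.
move=> oU; elim: m s => [|m IH] s.
  move=> hs x Ux; apply: (@continuous_comp _ _ _ s (fun N => N i j)).
    exact: hs.
  exact: coord_continuous.
move=> [ds hs].
have h x v (Ux : U x) := deriv_at_entry i j (deriv_at_derive v (ds x Ux)).
split=> [x Ux|v]; first exact: (h x 0 Ux).1.
by apply: cont_diff_ext oU _ (IH _ (hs v)) => x Ux; rewrite (h x v Ux).2.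
Qed.

Lemma cont_diff_family (W : normedModType R) m k l (U : set V)
    (B : V -> 'M[R]_(k, l) -> W) (s : V -> 'M[R]_(k, l)) :
  open U -> (forall z, linear (B z)) -> (forall q, cont_diff m U (B^~ q)) ->
  cont_diff m U s -> cont_diff m U (fun z => B z (s z)).
Proof.
move=> oU lB hB hs.
have BE z : B z (s z) = \sum_a \sum_b s z a b *: B z (delta_mx a b).
  pose F : {linear 'M[R]_(k, l) -> W} :=
    HB.pack (B z) (GRing.isLinear.Build _ _ _ _ _ (lB z)).
  rewrite {1}[s z]matrix_sum_delta -[B z]/(F : _ -> _) linear_sum.
  by apply: eq_bigr => a _; rewrite linear_sum; apply: eq_bigr => b _; rewrite linearZ.
under eq_fun do rewrite BE.
apply: cont_diff_sum => // a; apply: cont_diff_sum => // b.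
by apply: cont_diff_scale => //; exact: cont_diff_entry.
Qed.

Lemma cont_diff_linear (W : normedModType R) m k l (U : set V)
    (L : 'M[R]_(k, l) -> W) (s : V -> 'M[R]_(k, l)) :
  open U -> linear L -> cont_diff m U s -> cont_diff m U (fun z => L (s z)).
Proof.
move=> oU lL; apply: (cont_diff_family (B := fun=> L)) => // q.
exact: cont_diff_cst.
Qed.

Lemma cont_diff_fst (V2 W : normedModType R) m (U : set V) (f : V -> W) :
  open U -> cont_diff m U f ->
  cont_diff m [set z : V * V2 | U z.1] (fun z => f z.1).
Proof.
move=> oU; elim: m f => [|m IH] f.
  move=> hf x Ux; apply: (@continuous_comp _ _ _ fst f); first exact: cvg_fst.
  exact: hf.
move=> [df hf].
have oU2 : open [set z : V * V2 | U z.1].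
  by apply: open_comp oU => z _; exact: cvg_fst.
have h (x : V * V2) v (Ux : U x.1) :=
  deriv_at_comp (deriv_at_fst (deriv_at_id x v)) (df x.1 Ux).
split=> [x Ux|v]; first exact: (h x 0 Ux).1.
by apply: cont_diff_ext oU2 _ (IH _ (hf v.1)) => x Ux; rewrite (h x v Ux).2.
Qed.

Lemma cont_diff_snd (V2 : normedModType R) m (U : set (V * V2)) :
  cont_diff m U (fun z => z.2).
Proof.
case: m => [|m]; first by move=> x _; exact: cvg_snd.
split=> [x _|v]; first exact: (deriv_at_snd (deriv_at_id x 0)).1.
have -> : (fun x => 'D_v (fun z : V * V2 => z.2) x) = fun=> v.2.
  by apply/funext => x; exact: (deriv_at_snd (deriv_at_id x v)).2.
exact: cont_diff_cst.
Qed.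

End SmoothProducts.

Section HorizontalLift.
Variables (R : realType) (n k : nat) (k_gt0 : (0 < k)%N) (M : manifold R n).
Variables (E : quat_bundle M k) (r : anchor E) (nabla : connection E).
Variable i : idx M.
Local Notation P := ('rV[R]_n * quat R)%type.
Local Notation theta := (theta k_gt0 nabla i).
Local Notation D := [set z : P | coords i z.1].

Lemma open_over_chart : open D.
Proof.
apply: (@open_comp _ _ fst (coords i)); last exact: chart_open.
by move=> z _; exact: cvg_fst.
Qed.

(** The formula for the lift makes sense for every quaternion [z.2], which gives fields on an open
    set of the ambient space, as [involutive] requires. *)
Lemma smooth_lift (s : P -> Hk R k) : smooth D s ->
  smooth D (fun z => (rho r i z.1 (s z), theta z (rho r i z.1 (s z)))).
Proof.
move=> hs m; have oD := open_over_chart.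
have sD (W : normedModType R) (f : 'rV[R]_n -> W) :
    smooth (coords i) f -> cont_diff m D (fun z : P => f z.1).
  by move=> hf; apply: (cont_diff_fst (quat R) _ (hf m)); exact: chart_open.
have hrho : cont_diff m D (fun z : P => rho r i z.1 (s z)).
  apply: (cont_diff_family (B := fun z : P => rho r i z.1)) => //.
    by move=> z; exact: linearP.
  by move=> q; apply: (sD _ (fun y => rho r i y q)); exact: rho_smooth.
have hconn (t : P -> Hk R k) : cont_diff m D t ->
    cont_diff m D (fun z : P => conn nabla i z.1 (rho r i z.1 (s z)) (t z)).
  apply: (cont_diff_family
    (B := fun z : P => conn nabla i z.1 (rho r i z.1 (s z)))) => //.
    by move=> z; exact: linearP.
  move=> q; apply: (cont_diff_family (B := fun (z : P) v => conn nabla i z.1 v q)) => //.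
    by move=> z c v w; rewrite linearP add_lfunE scale_lfunE.
  by move=> v; apply: (sD _ (fun y => conn nabla i y v q)); exact: conn_smooth.
have hlmul (t : P -> Hk R k) : cont_diff m D t ->
    cont_diff m D (fun z : P => lmulq z.2 (t z)).
  apply: (cont_diff_family (B := fun z : P => lmulq z.2)) => //.
    by move=> z; exact: lmulq_linearr.
  move=> q; apply: (cont_diff_linear oD (@lmulq_linearl R k q)).
  exact: cont_diff_snd.
apply: cont_diff_pair => //.
(* [theta] is by construction a row of a commutator evaluated at the constant [unit_column]. *)
apply: (cont_diff_linear (L := row (Ordinal k_gt0))) => //.
  by move=> c a b; rewrite linearP.
apply: cont_diffD => //; first by apply/hlmul/hconn; exact: cont_diff_cst.
apply: (cont_diff_linear (L := fun x => - x)) => //.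
  by move=> c a b; rewrite opprD scalerN.
by apply/hconn/hlmul; exact: cont_diff_cst.
Qed.

Lemma smooth_lmulq (q : Hk R k) : smooth D (fun z => lmulq z.2 q).
Proof.
move=> m; apply: (cont_diff_linear open_over_chart (@lmulq_linearl R k q)).
exact: cont_diff_snd.
Qed.

End HorizontalLift.

Theorem theorem2p1 (R : realType) (n k : nat) (k_gt0 : (0 < k)%N)
    (M : manifold R n) (E : quat_bundle M k) (r : anchor E)
    (nabla : connection E) (coCR : almost_coCR r) :
  integrable_coCR r nabla <->
  (forall (i : idx M) (y : 'rV[R]_n) (u : quat R),
     coords i y -> imag_unit u ->
     (forall (v w : cplx 'rV[R]_n) (e : cplx (Hk R k)),
        rhoEJ r i y u v -> rhoEJ r i y u w -> EJ u e ->
        EJ u (ext2 (fun (g : Hk R k -> Hk R k) q => g q)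
                   (ext2 (curvature nabla i y) v w) e)) /\
     (forall e1 e2 : cplx (Hk R k),
        EJ u e1 -> EJ u e2 ->
        rhoEJ r i y u (ext2 (torsion r nabla i y) e1 e2))).
Proof.
split=> [integ i y u Uy hu|RT i W X1 X2 Y1 Y2 oW WU sX1 sX2 sY1 sY2 hX hY p Wp tp].
- have tp : twistor i (y, u) by [].
  pose D := [set z : 'rV[R]_n * quat R | coords i z.1].
  have oD : open D by exact: open_over_chart.
  have Dp : D (y, u) by [].
  (* Test fields: with [q] constant, [q + i u q] is a section of [E^J] over the whole chart with
     prescribed value, and its lift has [w = 0]. *)
  pose X (s : 'rV[R]_n * quat R -> Hk R k) z :=
    (rho r i z.1 (s z), theta k_gt0 nabla i z (rho r i z.1 (s z))).
  have key q q' :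
      rhoEJ r i y u (ext2 (torsion r nabla i y) (q, lmulq u q) (q', lmulq u q')) /\
      forall e, EJ u e -> EJ u (ext2 (fun (g : Hk R k -> Hk R k) x => g x)
        (ext2 (curvature nabla i y)
           (rho r i y q, rho r i y (lmulq u q))
           (rho r i y q', rho r i y (lmulq u q'))) e).
    have sX q0 : smooth D (X (fun=> q0)).
      by apply: smooth_lift => m; exact: cont_diff_cst.
    have sX' q0 : smooth D (X (fun z => lmulq z.2 q0)).
      by apply: smooth_lift; exact: smooth_lmulq.
    have hC q0 z : D z -> twistor i z ->
        CJ r nabla i z (X (fun=> q0) z, X (fun z => lmulq z.2 q0) z).
      move=> _ tz; apply/(CJP k_gt0 r nabla _ tz); exists q0, 0; split=> /=.
      + by rewrite mulr0 mul0r addr0.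
      + by rewrite addr0.
      + by rewrite mulr0 addr0.
    have hZ := integ i D _ _ _ _ oD (fun z h => h) (sX q) (sX' q) (sX q') (sX' q')
      (hC q) (hC q') (y, u) Uy tp.
    have dX s : smooth D (X s) -> differentiable (X s) (y, u).
      by move=> h; exact: (h 1%N).1.
    have t0 : (y, u).2 * 0 + 0 * (y, u).2 = 0 :> quat R.
      by rewrite mulr0 mul0r addr0.
    have e1 q0 : X (fun=> q0) (y, u) = (rho r i (y, u).1 q0,
        theta k_gt0 nabla i (y, u) (rho r i (y, u).1 q0) + 0) by rewrite addr0.
    have e2 q0 : X (fun z => lmulq z.2 q0) (y, u) = (rho r i (y, u).1 (lmulq u q0),
        theta k_gt0 nabla i (y, u) (rho r i (y, u).1 (lmulq u q0)) + (y, u).2 * 0).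
      by rewrite mulr0 addr0.
    have [[e [T1 T2]] hR] := (CJ_bracketP coCR oD Dp tp (fun z h => h)
      (dX _ (sX q)) (dX _ (sX' q)) (dX _ (sX q')) (dX _ (sX' q')) (hC q) (hC q')
      t0 t0 (e1 q) (e2 q) (e1 q') (e2 q')).1 hZ.
    split; last exact: (curvature_EJP k_gt0 nabla _ _ _ _ tp).2 hR.
    apply/(rhoEJP r i _ _ hu); exists e.
    by rewrite -[rho r i y e]T1 -[rho r i y (lmulq u e)]T2.
  split=> [v w e /(rhoEJP r i _ _ hu)[q ->] /(rhoEJP r i _ _ hu)[q' ->]|].
    exact: (key q q').2.
  move=> [q1 q2] [q1' q2'] /(EJP _ hu) /= -> /(EJP _ hu) /= ->.
  exact: (key q1 q1').1.
- have [Uy hu] := tp.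
  have [hR hT] := RT i p.1 p.2 Uy hu.
  have [q [w [tw e1 e2]]] := (CJP k_gt0 r nabla _ tp).1 (hX p Wp tp).
  have [q' [w' [tw' e1' e2']]] := (CJP k_gt0 r nabla _ tp).1 (hY p Wp tp).
  have dd (X : _ -> 'rV[R]_n * quat R) : smooth W X -> differentiable X p.
    by move=> sX; exact: (sX 1%N).1.
  (* The bracket is now tested by conditions on the values of the two sections at [p] only. *)
  refine ((CJ_bracketP coCR oW Wp tp WU (dd _ sX1) (dd _ sX2) (dd _ sY1)
    (dd _ sY2) hX hY tw tw' e1 e2 e1' e2').2 _).
  split.
    have ex (x : Hk R k) : EJ p.2 (x, lmulq p.2 x) by apply/(EJP _ hu).
    have /(rhoEJP r i _ _ hu)[e eE] := hT _ _ (ex q) (ex q').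
    by exists e; split; [exact: (congr1 fst eE) | exact: (congr1 snd eE)].
  apply/(curvature_EJP k_gt0 nabla _ _ _ _ tp) => e he.
  by apply: hR => //; apply/(rhoEJP r i _ _ hu); [exists q | exists q'].
Qed.
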